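(* Let $c\in\mathbb{R}^n$ satisfy $\alpha(c)>\max_{x\in\mathbb{T}^n}V(x)$, and let $u_c$ be a $\mathbb{Z}^n$-periodic semiconcave (viscosity) solution of $H(x,c+Du(x))=\alpha(c)$, where $H(x,p)=\frac12\langle A(x)p,p\rangle+V(x)$, regarded as a function on $\mathbb{R}^n$. If $x_0\in\Sigma_{u_c}$, then there exist $\tau>0$ and a Lipschitz arc $\mathbf{x}:[0,\tau)\to\mathbb{R}^n$ such that $\mathbf{x}(0)=x_0$, the right derivative $\dot{\mathbf{x}}^+(0)$ exists and $\dot{\mathbf{x}}^+(0)\neq 0$, and $\mathbf{x}(t)\in\Sigma_{u_c}$ for all $t\in[0,\tau)$.
   Context: $A(x)$ is a symmetric positive definite $n\times n$ matrix, smooth and $\mathbb{Z}^n$-periodic in $x\in\mathbb{R}^n$; $V$ is a smooth $\mathbb{Z}^n$-periodic real function on $\mathbb{R}^n$; $\mathbb{T}^n=\mathbb{R}^n/\mathbb{Z}^n$ is the flat torus. For $c\in\mathbb{R}^n$, $\alpha(c)$ (Mather's $\alpha$-function) is the unique real number such that $H(x,c+Du(x))=\alpha(c)$ admits a $\mathbb{Z}^n$-periodic viscosity solution. Such solutions (also called weak KAM solutions) are locally semiconcave with linear modulus. For a continuous function $w$, $D^+w(x)=\{p\in\mathbb{R}^n:\limsup_{y\to x}\frac{w(y)-w(x)-\langle p,y-x\rangle}{|y-x|}\leqslant 0\}$ and $D^-w(x)=\{p\in\mathbb{R}^n:\liminf_{y\to x}\frac{w(y)-w(x)-\langle p,y-x\rangle}{|y-x|}\geqslant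 0\}$. A continuous function $u$ is a viscosity solution of $H(x,c+Du(x))=\alpha(c)$ if for every $x$: $H(x,c+p)\leqslant\alpha(c)$ for all $p\in D^+u(x)$, and $H(x,c+p)\geqslant\alpha(c)$ for all $p\in D^-u(x)$. A function $w$ on a convex open set $\Omega$ is semiconcave (with linear modulus) if there is $C>0$ such that $w(\cdot)-\frac C2|\cdot|^2$ is concave on $\Omega$. The singular set $\Sigma_{u_c}$ is the set of points $x\in\mathbb{R}^n$ at which $D^+u_c(x)$ is not a singleton. *)

(* Defs.v *)
From HB Require Import structures.
From mathcomp Require Import all_boot all_order all_algebra.
From mathcomp Require Import all_classical all_reals all_analysis.

Set Implicit Arguments.
Unset Strict Implicit.
Unset Printing Implicit Defensive.

Import Order.TTheory GRing.Theory Num.Theory.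
Import numFieldNormedType.Exports.

Local Open Scope classical_set_scope.
Local Open Scope ring_scope.

(* Points, momenta and velocities are row vectors.  The library norm on        *)
(* 'rV[R]_n is the sup norm; its topology is the Euclidean one, but the        *)
(* Euclidean norm and inner product have to be introduced separately.          *)

Definition dot (R : realType) (n : nat) (p q : 'rV[R]_n) : R :=
  \sum_(i < n) p 0 i * q 0 i.

Definition enorm (R : realType) (n : nat) (p : 'rV[R]_n) : R :=
  Num.sqrt (dot p p).

Definition Zperiodic (R : realType) (n : nat) (T : Type)
    (f : 'rV[R]_n -> T) : Prop :=
  forall (k : 'rV[int]_n) (x : 'rV[R]_n), f (x + map_mx intr k) = f x.

(* C^k: all iterated partial derivatives up to order k exist and are           *)
(* continuous.                                                                 *)
Fixpoint Ck (R : realType) (n k : nat) (f : 'rV[R]_n -> R) : Prop :=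
  if k is k'.+1 then
    continuous f /\
    forall i : 'I_n,
      (forall x, derivable f x (delta_mx 0 i)) /\
      Ck k' (fun x => 'D_(delta_mx 0 i) f x)
  else continuous f.

Definition smooth (R : realType) (n : nat) (f : 'rV[R]_n -> R) : Prop :=
  forall k, Ck k f.

(* p *m M^T is the row vector (M p)^T. *)
Definition posdefmx (R : realType) (n : nat) (M : 'M[R]_n) : Prop :=
  M^T = M /\ forall p : 'rV[R]_n, p != 0 -> 0 < dot (p *m M^T) p.

Definition hamiltonian (R : realType) (n : nat) (A : 'rV[R]_n -> 'M[R]_n)
    (V : 'rV[R]_n -> R) (x p : 'rV[R]_n) : R :=
  2^-1 * dot (p *m (A x)^T) p + V x.

Definition superdiff (R : realType) (n : nat) (w : 'rV[R]_n -> R)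
    (x : 'rV[R]_n) : set 'rV[R]_n :=
  [set p | (limf_esup
     (fun y => ((w y - w x - dot p (y - x)) / enorm (y - x))%:E) x^' <= 0)%E].

Definition subdiff (R : realType) (n : nat) (w : 'rV[R]_n -> R)
    (x : 'rV[R]_n) : set 'rV[R]_n :=
  [set p | (0 <= limf_einf
     (fun y => ((w y - w x - dot p (y - x)) / enorm (y - x))%:E) x^')%E].

(* Viscosity solutions of H(x, c + Dw(x)) = a. *)
Definition viscosity_solution (R : realType) (n : nat)
    (H : 'rV[R]_n -> 'rV[R]_n -> R) (c : 'rV[R]_n) (a : R)
    (w : 'rV[R]_n -> R) : Prop :=
  continuous w /\
  forall x,
    (forall p, superdiff w x p -> H x (c + p) <= a) /\
    (forall p, subdiff w x p -> a <= H x (c + p)).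

(* Mather's alpha-function.  For continuous periodic Tonelli Hamiltonians      *)
(* exactly one level a is admissible, so that the choice made by get is        *)
(* immaterial.                                                                 *)
Definition mather_alpha (R : realType) (n : nat)
    (H : 'rV[R]_n -> 'rV[R]_n -> R) (c : 'rV[R]_n) : R :=
  get [set a : R | exists w : 'rV[R]_n -> R,
                     Zperiodic w /\ viscosity_solution H c a w].

(* Semiconcavity with linear modulus, for Omega convex and open.  The library  *)
(* only has convexity, whence the sign.                                        *)
Definition semiconcave (R : realType) (n : nat) (Omega : set 'rV[R]_n)
    (w : 'rV[R]_n -> R) : Prop :=
  exists2 C : R, 0 < C &
    convex_function Omega (fun x => - (w x - C / 2 * dot x x)).

Definition singular_set (R : realType) (n : nat) (w : 'rV[R]_n -> R) :
    set 'rV[R]_n :=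
  [set x | ~ exists p, superdiff w x = [set p]].

(* Main.v *)
Require Import Defs.
From HB Require Import structures.
From mathcomp Require Import all_boot all_order all_algebra.
From mathcomp Require Import all_classical all_reals all_analysis.
From mathcomp Require Import ring lra.

(** Put w(x) = u(x) + <c, x> and let |.| be the norm dual to the metric
    2 (alpha - V) A^-1, so that the equation reads |Dw| = 1: at every point x the
    convex set D = D^+w(x) lies in the unit ball and contains a unit vector.

    Assume first that D^+w(x0) is not the whole unit ball.  Since it contains two
    points, projecting a suitable point of the ball (the origin, if it is not in D)
    onto D yields r in D with |r| < 1 and q <> 0 with <q, p - r> >= 0 on D.  The
    maximisers x(s) of u - <r - c, .> - |. - x0 - s q|^2 / (2 s) form a Lipschitz arc
    with x'(0) = q, and the supergradients r(s) of w at x(s) given by the first order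
    condition tend to r.  Hence |r(s)| < 1 for small s, while some supergradient at
    x(s) has norm 1: so x(s) is singular.

    If D^+w(x0) is the whole unit ball, then w(x) <= w(x0) - |x - x0| + O(|x - x0|^2).
    Let d be the Riemannian distance from x0, which is semiconcave with constant
    1/d + O(1), and e = w + d - w(x0) >= 0.  Where both are differentiable,
    <De, Dd> = |De|^2 / 2 <= (1/d + E) e, and e = O(d^2) near x0, so that a maximum
    principle for e^2 exp(-2 E d) / d^3 gives e = 0.  Thus w < w(x0) away from x0,
    which contradicts w(x0 + k) + w(x0 - k) = 2 w(x0) for integer vectors k. *)

Set Implicit Arguments.
Unset Strict Implicit.
Unset Printing Implicit Defensive.

Import Order.TTheory GRing.Theory Num.Theory.
Import numFieldNormedType.Exports.

Local Open Scope classical_set_scope.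
Local Open Scope ring_scope.

(** * Quadratic forms and the Euclidean norm *)

Section Forms.
Context {R : realType} {n : nat}.
Implicit Types (M : 'M[R]_n) (p q v : 'rV[R]_n) (t : R).

(** The function - |x| solves |Dw| = 1 with an isolated singularity at 0, where its
    superdifferential is the whole unit ball. Such a vertex is therefore possible locally and can
    only be excluded globally, which is why the cone has to be propagated to all of R^n before
    lattice translations apply. The assumption on alpha(c) makes the metric uniformly nondegenerate.

    The maximum principle has a window of exponents. Up to the exponential factor, e grows at most
    like d along the gradient of d, so e^2 / d^s decreases for s > 2, while e = O(d^2) makes it
    vanish at x0 for s < 4; s = 3 is one choice.

    Nothing is differentiated along geodesics or almost everywhere. The distance is an infimum over
    polygons, whose second order behaviour is found by induction on the edges. Points of
    differentiability are replaced by the dense set of points touched from below by a paraboloid.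
    Supergradients are global quadratic upper bounds with one fixed constant, a condition stable
    under limits. The differential inequality for e becomes a statement about short finite steps. *)

Lemma dotE p q : dot p q = (p *m q^T) 0 0.
Proof. by rewrite mxE; apply: eq_bigr => i _; rewrite mxE. Qed.

Lemma dotC p q : dot p q = dot q p.
Proof. by apply: eq_bigr => i _; rewrite mulrC. Qed.

Lemma dotDl p q v : dot (p + q) v = dot p v + dot q v.
Proof. by rewrite !dotE mulmxDl mxE. Qed.

Lemma dotZl t p v : dot (t *: p) v = t * dot p v.
Proof. by rewrite !dotE -scalemxAl mxE. Qed.

Lemma dotDr p q v : dot v (p + q) = dot v p + dot v q.
Proof. by rewrite dotC dotDl !(dotC v). Qed.

Lemma dotZr t p v : dot v (t *: p) = t * dot v p.
Proof. by rewrite dotC dotZl dotC. Qed.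

Lemma dotNl p v : dot (- p) v = - dot p v.
Proof. by rewrite -scaleN1r dotZl mulN1r. Qed.

Lemma dotNr p v : dot v (- p) = - dot v p.
Proof. by rewrite dotC dotNl dotC. Qed.

Lemma dotBl p q v : dot (p - q) v = dot p v - dot q v.
Proof. by rewrite dotDl dotNl. Qed.

Lemma dotBr p q v : dot v (p - q) = dot v p - dot v q.
Proof. by rewrite dotDr dotNr. Qed.

Lemma dot0l v : dot 0 v = 0.
Proof. by rewrite -(scale0r 0) dotZl mul0r. Qed.

Lemma dot0r v : dot v 0 = 0.
Proof. by rewrite dotC dot0l. Qed.

Lemma dot_ge0 v : 0 <= dot v v.
Proof. by apply: sumr_ge0 => i _; rewrite -expr2 sqr_ge0. Qed.

Lemma dot_eq0 v : (dot v v == 0) = (v == 0).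
Proof.
apply/idP/idP => [|/eqP->]; last by rewrite dot0l.
rewrite /dot psumr_eq0 => [/allP v0|i _]; last by rewrite -expr2 sqr_ge0.
apply/eqP/rowP => i; rewrite mxE; have := v0 i; rewrite mem_index_enum.
by move=> /(_ isT); rewrite -expr2 sqrf_eq0 => /eqP.
Qed.

Lemma dot_mulmx p M q : dot (p *m M) q = dot p (q *m M^T).
Proof. by rewrite !dotE trmx_mul trmxK mulmxA. Qed.

Definition bform M p q : R := dot (p *m M) q.

Lemma bformDl M p q v : bform M (p + q) v = bform M p v + bform M q v.
Proof. by rewrite /bform mulmxDl dotDl. Qed.

Lemma bformDr M p q v : bform M v (p + q) = bform M v p + bform M v q.
Proof. by rewrite /bform dotDr. Qed.

Lemma bformZl M t p v : bform M (t *: p) v = t * bform M p v.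
Proof. by rewrite /bform -scalemxAl dotZl. Qed.

Lemma bformZr M t p v : bform M v (t *: p) = t * bform M v p.
Proof. by rewrite /bform dotZr. Qed.

Lemma bformNl M p v : bform M (- p) v = - bform M p v.
Proof. by rewrite -scaleN1r bformZl mulN1r. Qed.

Lemma bformNr M p v : bform M v (- p) = - bform M v p.
Proof. by rewrite -scaleN1r bformZr mulN1r. Qed.

Lemma bform0l M v : bform M 0 v = 0.
Proof. by rewrite /bform mul0mx dot0l. Qed.

Lemma bformC M p q : M^T = M -> bform M p q = bform M q p.
Proof. by move=> symM; rewrite /bform dot_mulmx symM dotC. Qed.

Lemma bform1 p q : bform 1%:M p q = dot p q.
Proof. by rewrite /bform mulmx1. Qed.

Definition psdmx M : Prop := M^T = M /\ forall v, 0 <= bform M v v.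

Lemma bform_sqrD M p q t : psdmx M ->
  bform M (p + t *: q) (p + t *: q) =
  bform M p p + 2 * t * bform M p q + t ^+ 2 * bform M q q.
Proof.
move=> [symM _]; rewrite !(bformDl, bformDr, bformZl, bformZr).
by rewrite (bformC q p symM); ring.
Qed.

Lemma psdmx1 : psdmx 1%:M.
Proof. by split=> [|v]; rewrite ?trmx1// bform1 dot_ge0. Qed.

Lemma bform_CauchySchwarz M p q : psdmx M ->
  bform M p q ^+ 2 <= bform M p p * bform M q q.
Proof.
move=> [symM M0]; have symf := bformC p q symM.
have quad s t : 0 <= s ^+ 2 * bform M p p + 2 * s * t * bform M p q
                     + t ^+ 2 * bform M q q.
  have := M0 (s *: p + t *: q).
  rewrite !(bformDl, bformDr, bformZl, bformZr) -symf.
  by congr (0 <= _); ring.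
have [q0|qn0] := eqVneq (bform M q q) 0; last first.
  have q_gt0 : 0 < bform M q q by rewrite lt_neqAle eq_sym qn0 M0.
  rewrite -subr_ge0 -(pmulr_rge0 _ q_gt0).
  have := quad (bform M q q) (- bform M p q).
  by congr (0 <= _); ring.
have [->|pqn0] := eqVneq (bform M p q) 0.
  by rewrite expr0n mulr_ge0.
(* With q isotropic the form is affine along p + t q; this t would give it the value -1. *)
pose t := - (bform M p p + 1) / (2 * bform M p q).
have tpq : 2 * t * bform M p q = - (bform M p p + 1) by rewrite /t; field.
by have := quad 1 t; rewrite q0 mulr0 mulr1 tpq expr1n; lra.
Qed.

Definition mnorm M v : R := Num.sqrt (bform M v v).

Lemma enormE v : enorm v = mnorm 1%:M v.
Proof. by rewrite /enorm /mnorm bform1. Qed.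

Lemma mnorm_ge0 M v : 0 <= mnorm M v.
Proof. exact: sqrtr_ge0. Qed.

Lemma sqr_mnorm M v : psdmx M -> mnorm M v ^+ 2 = bform M v v.
Proof. by move=> [_ M0]; rewrite sqr_sqrtr. Qed.

Lemma mnormZ M t v : mnorm M (t *: v) = `|t| * mnorm M v.
Proof.
rewrite /mnorm bformZl bformZr mulrA -expr2 sqrtrM ?sqr_ge0//.
by rewrite sqrtr_sqr.
Qed.

Lemma mnormN M v : mnorm M (- v) = mnorm M v.
Proof. by rewrite -scaleN1r mnormZ normrN1 mul1r. Qed.

Lemma mnorm0 M : mnorm M 0 = 0.
Proof. by rewrite /mnorm bform0l sqrtr0. Qed.

Lemma bform_le_mnorm M p q : psdmx M ->
  `|bform M p q| <= mnorm M p * mnorm M q.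
Proof.
move=> psdM; rewrite -ler_sqr ?nnegrE ?normr_ge0 ?mulr_ge0 ?mnorm_ge0//.
by rewrite real_normK ?num_real// exprMn !sqr_mnorm// bform_CauchySchwarz.
Qed.

Lemma ler_mnormD M p q : psdmx M ->
  mnorm M (p + q) <= mnorm M p + mnorm M q.
Proof.
move=> psdM.
rewrite -ler_sqr ?nnegrE ?addr_ge0 ?mnorm_ge0// sqrrD !sqr_mnorm//.
rewrite !(bformDl, bformDr) (bformC q p (proj1 psdM)).
have := le_trans (ler_norm _) (bform_le_mnorm p q psdM).
by move=> h; lra.
Qed.

Lemma enorm_ge0 v : 0 <= enorm v.
Proof. exact: sqrtr_ge0. Qed.

Lemma sqr_enorm v : enorm v ^+ 2 = dot v v.
Proof. by rewrite sqr_sqrtr ?dot_ge0. Qed.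

Lemma enormZ t v : enorm (t *: v) = `|t| * enorm v.
Proof. by rewrite !enormE mnormZ. Qed.

Lemma enormN v : enorm (- v) = enorm v.
Proof. by rewrite !enormE mnormN. Qed.

Lemma enorm0 : enorm (0 : 'rV[R]_n) = 0.
Proof. by rewrite enormE mnorm0. Qed.

Lemma enorm_eq0 v : (enorm v == 0) = (v == 0).
Proof. by rewrite -sqrf_eq0 sqr_enorm dot_eq0. Qed.

Lemma enorm_gt0 v : (0 < enorm v) = (v != 0).
Proof. by rewrite lt_neqAle enorm_ge0 eq_sym enorm_eq0 andbT. Qed.

Lemma ler_enormD p q : enorm (p + q) <= enorm p + enorm q.
Proof. by rewrite !enormE; apply: ler_mnormD psdmx1. Qed.

Lemma enormBC p q : enorm (p - q) = enorm (q - p).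
Proof. by rewrite -opprB enormN. Qed.

Lemma ler_enorm_sub p q : enorm p - enorm q <= enorm (p - q).
Proof. by rewrite lerBlDr -{1}(subrK q p) ler_enormD. Qed.

Lemma normr_dot_le p q : `|dot p q| <= enorm p * enorm q.
Proof. by rewrite !enormE -bform1; apply: bform_le_mnorm psdmx1. Qed.

Lemma dot_le p q : dot p q <= enorm p * enorm q.
Proof. exact: le_trans (ler_norm _) (normr_dot_le p q). Qed.

Lemma normr_coord_le v i : `|v 0 i| <= enorm v.
Proof.
rewrite -ler_sqr ?nnegrE ?normr_ge0 ?enorm_ge0// sqr_enorm real_normK ?num_real//.
rewrite /dot (bigD1 i)//= expr2 lerDl.
by apply: sumr_ge0 => j _; rewrite -expr2 sqr_ge0.
Qed.

Lemma normr_le_enorm v : `|v| <= enorm v.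
Proof.
rewrite [leLHS]/Num.norm/= mx_normrE.
by apply: bigmax_le => [|[i j] _]; rewrite ?enorm_ge0//= ord1 normr_coord_le.
Qed.

Lemma enorm_le_normr v : enorm v <= n%:R * `|v|.
Proof.
rewrite -ler_sqr ?nnegrE ?enorm_ge0 ?mulr_ge0// sqr_enorm /dot.
have coordle i : v 0 i * v 0 i <= `|v| ^+ 2.
  rewrite -expr2 -real_normK ?num_real// ler_sqr ?nnegrE//.
  rewrite [leRHS]/Num.norm/= mx_normrE.
  exact: (@le_bigmax _ _ _ 0 (fun ij : 'I_1 * 'I_n => `|v ij.1 ij.2|) (0, i)).
apply: (le_trans (ler_sum _ (fun i _ => coordle i))).
rewrite sumr_const card_ord -[leLHS]mulr_natl exprMn; apply: ler_wpM2r.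
  exact: sqr_ge0.
case: (n) => [|k]; first by rewrite expr0n.
by rewrite -natrX ler_nat leq_pmulr.
Qed.

End Forms.

(** * Compactness *)

Section Topology.
Context {R : realType} {n : nat}.
Implicit Types (x y p q v : 'rV[R]_n) (f g : 'rV[R]_n -> R).

Lemma nbhs_enormP x (A : set 'rV[R]_n) :
  nbhs x A <-> exists2 e, 0 < e & forall y, enorm (y - x) < e -> A y.
Proof.
split=> [/nbhs_ballP[e /= e0 eA]|[e e0 eA]].
  exists e => // y yx; apply: eA; rewrite -ball_normE/= distrC.
  exact: le_lt_trans (normr_le_enorm _) yx.
apply/nbhs_ballP; exists (e / n.+1%:R) => /=; first by rewrite divr_gt0.
move=> y; rewrite -ball_normE/= distrC => yx; apply: eA.
apply: (le_lt_trans (enorm_le_normr _)).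
rewrite ltr_pdivlMr// mulrC in yx; apply: le_lt_trans yx.
by rewrite ler_wpM2r// ler_nat.
Qed.

Lemma continuous_enormP f : continuous f <->
  forall x e, 0 < e -> exists2 d, 0 < d &
    forall y, enorm (y - x) < d -> `|f y - f x| < e.
Proof.
split=> [cf x e e0|cf x].
  have /cvgrPdist_lt/(_ e e0)/nbhs_enormP[d d0 dP] := cf x.
  by exists d => // y /dP; rewrite distrC.
apply/(@cvgrPdist_lt _ _ _ (nbhs x)) => e /(cf x)[d d0 dP].
by apply/nbhs_enormP; exists d => // y /dP; rewrite distrC.
Qed.

Lemma continuous_dotl p : continuous (dot p).
Proof.
apply/continuous_enormP => x e e0; exists (e / (enorm p + 1)) => [|y].
  by rewrite divr_gt0// ltr_wpDl ?enorm_ge0.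
rewrite ltr_pdivlMr ?ltr_wpDl ?enorm_ge0// -dotBr => yx.
apply: (le_lt_trans (normr_dot_le _ _)); apply: le_lt_trans yx.
by rewrite mulrC ler_wpM2l ?enorm_ge0// lerDl.
Qed.

Lemma continuous_enormB y : continuous (fun x => enorm (x - y)).
Proof.
apply/continuous_enormP => x e e0; exists e => // z zx.
apply: le_lt_trans zx; rewrite ler_norml.
have := ler_enorm_sub (z - y) (x - y); have := ler_enorm_sub (x - y) (z - y).
by rewrite (enormBC (x - y)) !opprB !addrA !subrK; lra.
Qed.

Lemma continuous_sqr_enormB y : continuous (fun x => enorm (x - y) ^+ 2).
Proof.
move=> x.
by apply: (@continuousM _ _ (fun x => enorm (x - y)) (fun x => enorm (x - y)));
  apply: continuous_enormB.
Qed.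

Lemma closed_enorm_ball y r : closed [set x | enorm (x - y) <= r].
Proof.
exact: (closed_comp (fun x _ => @continuous_enormB y x) (@closed_le R r)).
Qed.

Lemma compact_enorm_ball y r : compact [set x | enorm (x - y) <= r].
Proof.
apply: bounded_closed_compact; last exact: closed_enorm_ball.
exists (r + enorm y); split; first exact: num_real.
move=> M rM x /= xr; apply: (le_trans (normr_le_enorm _)).
rewrite -(subrK y x); apply: (le_trans (ler_enormD _ _)); lra.
Qed.

(** A cluster point in explicit form: close indices can be taken arbitrarily large, which stands in
    for extracting a subsequence. *)
Lemma bounded_seq_cluster (s : nat -> 'rV[R]_n) B :
  (forall k, enorm (s k) <= B) ->
  exists l, forall e N, 0 < e -> exists2 k, (N <= k)%N & enorm (s k - l) < e.
Proof.
move=> sB.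
have [|l [_ sl]] := @compact_enorm_ball 0 B (s @ \oo) _.
  by exists 0%N => // k _ /=; rewrite subr0.
exists l => e N e0.
have [||_ [[k Nk <-] kl]] := sl (s @` [set k | (N <= k)%N])
  [set y | enorm (y - l) < e].
- by exists N => // k /= Nk; exists k.
- by apply/nbhs_enormP; exists e.
- by exists k.
Qed.

Lemma Zperiodic_bounded f : Zperiodic f -> continuous f ->
  exists2 B, 0 <= B & forall x, `|f x| <= B.
Proof.
move=> pf cf.
have [||c _ fc] := @compact_EVT_max _ _ (fun x => `|f x|)
  [set x | enorm (x - 0) <= n%:R] _ (@compact_enorm_ball _ _).
- by exists 0; rewrite /= subrr enorm0.
- apply: continuous_subspaceT => x.
  by apply: (@continuous_comp _ _ _ f Num.norm); [exact: cf|exact: norm_continuous].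
exists `|f c| => // x.
(* Translation into the unit cube, which lies in the Euclidean ball of radius n. *)
pose k : 'rV[int]_n := \row_i - Num.floor (x 0 i).
rewrite -(pf k x); apply: fc; rewrite inE/= subr0.
apply: (le_trans (enorm_le_normr _)).
rewrite -[leRHS]mulr1 ler_wpM2l// [leLHS]/Num.norm/= mx_normrE.
apply: bigmax_le => // -[i j] _ /=; rewrite ord1 !mxE.
have := floor_le (x 0 j); have := floorD1_gt (x 0 j).
by rewrite intrN intrD ler_norml; lra.
Qed.

Lemma Zperiodic_min_gt0 f : Zperiodic f -> continuous f ->
  (forall x, 0 < f x) -> exists2 m, 0 < m & forall x, m <= f x.
Proof.
move=> pf cf f0.
have [||B B0 fB] := @Zperiodic_bounded (fun x => (f x)^-1).
- by move=> k x; rewrite pf.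
- by move=> x; apply: continuousV (cf x); rewrite gt_eqF.
exists (B + 1)^-1 => [|x]; first by rewrite invr_gt0 ltr_wpDl.
rewrite -[leRHS]invrK lef_pV2 ?posrE ?invr_gt0 ?ltr_wpDl//.
by apply: (le_trans (le_trans (ler_norm _) (fB x))); rewrite lerDl.
Qed.

End Topology.

(** * Functions with uniform first order Taylor expansions *)

Section Taylor.
Context {R : realType} {n : nat}.
Implicit Types (x y p q v xi : 'rV[R]_n) (f g : 'rV[R]_n -> R).

(** Uniform C^{1,1} regularity in terms of expansions: a class closed under sums, products, inverses
    and determinants, hence suited to the inverse of a matrix. *)
Definition taylor1 f : Prop := exists2 K, 0 <= K & forall x,
  `|f x| <= K /\ exists2 g, enorm g <= K &
    forall xi, `|f (x + xi) - f x - dot g xi| <= K * enorm xi ^+ 2.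

Lemma taylor1_lipschitz f : taylor1 f -> exists2 K, 0 <= K &
  forall x xi, `|f (x + xi) - f x| <= K * enorm xi.
Proof.
move=> [K K0 fK]; exists (2 * K) => [|x xi]; first by rewrite mulr_ge0.
have [fx [g gK gP]] := fK x; have [fy _] := fK (x + xi).
have e0 := enorm_ge0 xi.
(* Long increments are controlled by the bound on f, short ones by the expansion. *)
have [e1|e1] := leP (enorm xi) 1; last first.
  apply: (le_trans (ler_normB _ _)).
  apply: (le_trans (lerD fy fx)).
  have : 0 <= K * (enorm xi - 1) by rewrite mulr_ge0// subr_ge0 ltW.
  by move=> ?; lra.
rewrite -(subrK (dot g xi) (f _ - _)); apply: (le_trans (ler_normD _ _)).
rewrite mulrDl mul1r mulrDl; apply: lerD.
  apply: (le_trans (gP xi)); rewrite expr2 mulrA ler_piMr// mulr_ge0//.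
by apply: (le_trans (normr_dot_le _ _)); rewrite ler_wpM2r.
Qed.

Lemma taylor1_continuous f : taylor1 f -> continuous f.
Proof.
move=> /taylor1_lipschitz[K K0 fK]; apply/continuous_enormP => x e e0.
exists (e / (K + 1)) => [|y]; first by rewrite divr_gt0// ltr_wpDl.
rewrite ltr_pdivlMr ?ltr_wpDl// => yx.
have := fK x (y - x); rewrite [x + _]addrC subrK => /le_lt_trans; apply.
by apply: le_lt_trans yx; rewrite mulrC ler_wpM2l ?enorm_ge0// lerDl.
Qed.

Lemma taylor1_cst (c : R) : taylor1 (fun=> c).
Proof.
exists `|c| => // x; split=> //; exists 0; rewrite ?enorm0// => xi.
by rewrite dot0l !subr0 subrr normr0 mulr_ge0// sqr_ge0.
Qed.

Lemma taylor1D f g : taylor1 f -> taylor1 g -> taylor1 (fun x => f x + g x).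
Proof.
move=> [K K0 fK] [L L0 gL]; exists (K + L) => [|x]; first exact: addr_ge0.
have [fx [p pK pP]] := fK x; have [gx [q qL qP]] := gL x; split.
  by apply: (le_trans (ler_normD _ _)); apply: lerD.
exists (p + q) => [|xi]; first by apply: (le_trans (ler_enormD _ _)); apply: lerD.
rewrite (_ : _ - _ = (f (x + xi) - f x - dot p xi) +
  (g (x + xi) - g x - dot q xi)); last by rewrite dotDl; ring.
by apply: (le_trans (ler_normD _ _)); rewrite mulrDl; apply: lerD.
Qed.

Lemma taylor1M f g : taylor1 f -> taylor1 g -> taylor1 (fun x => f x * g x).
Proof.
move=> Tf Tg.
have [Kf Kf0 lf] := taylor1_lipschitz Tf; have [Kg Kg0 lg] := taylor1_lipschitz Tg.
case: Tf => K K0 fK; case: Tg => L L0 gL.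
exists (K * L + K * L + Kf * Kg) => [|x]; first by rewrite !addr_ge0// mulr_ge0.
have [fx [p pK pP]] := fK x; have [gx [q qL qP]] := gL x; split.
  rewrite normrM; apply: (@le_trans _ _ (K * L)); first by apply: ler_pM.
  by rewrite -addrA lerDl addr_ge0// mulr_ge0.
exists (g x *: p + f x *: q) => [|xi].
  apply: (le_trans (ler_enormD _ _)); rewrite !enormZ.
  apply: (@le_trans _ _ (K * L + K * L)); last by rewrite lerDl mulr_ge0.
  by apply: lerD; [rewrite [leLHS]mulrC|]; apply: ler_pM; rewrite ?enorm_ge0.
rewrite (_ : _ - _ = g x * (f (x + xi) - f x - dot p xi) +
  f x * (g (x + xi) - g x - dot q xi) +
  (f (x + xi) - f x) * (g (x + xi) - g x)); last first.
  by rewrite dotDl !dotZl; ring.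
rewrite [leRHS]mulrDl [in leRHS]mulrDl; do 2?[apply: (le_trans (ler_normD _ _));
  apply: lerD].
- by rewrite normrM mulrAC [_ * L]mulrC; apply: ler_pM.
- by rewrite normrM -mulrA; apply: ler_pM.
- rewrite normrM expr2 mulrACA; exact: ler_pM.
Qed.

Lemma taylor1V f : taylor1 f -> (exists2 m, 0 < m & forall x, m <= f x) ->
  taylor1 (fun x => (f x)^-1).
Proof.
move=> Tf [m m0 mf]; have [J J0 lf] := taylor1_lipschitz Tf.
case: Tf => K K0 fK.
have f0 x : 0 < f x by exact: lt_le_trans (mf x).
have fVm x : (f x)^-1 <= m^-1 by rewrite lef_pV2 ?posrE.
have V0 x : 0 <= (f x)^-1 by rewrite invr_ge0 ltW.
have Vsq x : (f x)^-1 ^+ 2 <= m^-1 ^+ 2.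
  by rewrite ler_sqr ?nnegrE// invr_ge0 ltW.
have m10 : 0 <= m^-1 by rewrite invr_ge0 ltW.
exists (m^-1 + K * m^-1 ^+ 2 + (K * J + K * K) * m^-1 ^+ 3) => [|x].
  by rewrite !addr_ge0// mulr_ge0// ?addr_ge0 ?exprn_ge0// mulr_ge0.
have [fx [p pK pP]] := fK x; split.
  rewrite normrV ?unitfE ?gt_eqF// gtr0_norm//; apply: (le_trans (fVm x)).
  by rewrite -addrA lerDl !addr_ge0 ?mulr_ge0// ?addr_ge0 ?exprn_ge0 ?mulr_ge0.
exists (- (f x)^-1 ^+ 2 *: p) => [|xi].
  rewrite enormZ normrN ger0_norm ?exprn_ge0 ?invr_ge0 ?(ltW (f0 x))//.
  apply: (@le_trans _ _ (K * m^-1 ^+ 2)); last first.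
    by rewrite addrAC lerDr ?addr_ge0 ?mulr_ge0// ?addr_ge0 ?exprn_ge0 ?mulr_ge0.
  by rewrite mulrC; apply: ler_pM => //; rewrite ?enorm_ge0 ?exprn_ge0.
set r := f (x + xi) - f x - dot p xi.
rewrite (_ : _ - _ = (dot p xi * (f (x + xi) - f x) - r * f x) *
    ((f x)^-1 ^+ 2 * (f (x + xi))^-1)); last first.
  by rewrite dotZl /r; field; rewrite !gt_eqF.
apply: (@le_trans _ _ (((K * J + K * K) * enorm xi ^+ 2) * m^-1 ^+ 3)); last first.
  rewrite mulrAC ler_wpM2r ?sqr_ge0// lerDr.
  by rewrite addr_ge0 ?mulr_ge0 ?exprn_ge0.
rewrite normrM; apply: ler_pM => //; last first.
  by rewrite ger0_norm ?mulr_ge0 ?exprn_ge0// [leRHS]exprSr; apply: ler_pM;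
    rewrite ?exprn_ge0.
apply: (le_trans (ler_normB _ _)); rewrite !normrM mulrDl; apply: lerD.
  rewrite expr2 mulrACA; apply: ler_pM => //.
  by apply: (le_trans (normr_dot_le _ _)); rewrite ler_wpM2r ?enorm_ge0.
by rewrite [leRHS]mulrAC; apply: ler_pM => //; exact: pP.
Qed.

Lemma taylor1_sum (I : finType) (P : pred I) (F : I -> 'rV[R]_n -> R) :
  (forall i, taylor1 (F i)) -> taylor1 (fun x => \sum_(i | P i) F i x).
Proof.
move=> TF; elim: (index_enum I) => [|i s IH].
  under eq_fun do rewrite big_nil.
  exact: taylor1_cst.
under eq_fun do rewrite big_cons.
by case: (P i) => //; exact: taylor1D.
Qed.

Lemma taylor1_prod (I : finType) (F : I -> 'rV[R]_n -> R) :
  (forall i, taylor1 (F i)) -> taylor1 (fun x => \prod_i F i x).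
Proof.
move=> TF; elim: (index_enum I) => [|i s IH].
  under eq_fun do rewrite big_nil.
  exact: taylor1_cst.
under eq_fun do rewrite big_cons.
exact: taylor1M.
Qed.

Lemma taylor1_det m (F : 'rV[R]_n -> 'M[R]_m) :
  (forall i j, taylor1 (fun x => F x i j)) -> taylor1 (fun x => \det (F x)).
Proof.
move=> TF; apply: taylor1_sum => s; apply: taylor1M; first exact: taylor1_cst.
exact: taylor1_prod.
Qed.

(** Cofactors over the determinant. Writing 1 / det as det / det^2 puts a positive function under
    the inverse, as [taylor1V] asks, whatever the sign of det. *)
Lemma taylor1_invmx m (F : 'rV[R]_n -> 'M[R]_m) :
  (forall i j, taylor1 (fun x => F x i j)) ->
  (exists2 d, 0 < d & forall x, d <= \det (F x) * \det (F x)) ->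
  forall i j, taylor1 (fun x => invmx (F x) i j).
Proof.
move=> TF [d d0 dF] i j; have Tdet := taylor1_det TF.
have det0 x : \det (F x) != 0.
  apply/eqP => F0; have := dF x.
  by rewrite F0 mul0r leNgt d0.
rewrite (_ : (fun _ => _) = fun x => \det (F x) * (\det (F x) * \det (F x))^-1 *
    ((-1) ^+ (j + i) * \det (row' j (col' i (F x))))).
  apply: taylor1M.
    by apply: taylor1M => //; apply: taylor1V; [exact: taylor1M|exists d].
  apply: taylor1M; first exact: taylor1_cst.
  apply: taylor1_det => k l; under eq_fun do rewrite !mxE.
  exact: TF.
apply/funext => x; rewrite /invmx unitmxE unitfE det0.
have -> : \det (F x) * (\det (F x) * \det (F x))^-1 = (\det (F x))^-1.
  by field; exact: det0.
by rewrite !mxE.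
Qed.

Lemma is_derive_line f x v (t : R) : (forall y, derivable f y v) ->
  is_derive t (1 : R) (fun s : R => f (x + s *: v)) ('D_v f (x + t *: v)).
Proof.
move=> df; have eqf : (fun h : R => h^-1 *: (((fun s => f (x + s *: v)) \o shift t)
      (h *: 1) - f (x + t *: v))) =
    fun h => h^-1 *: ((f \o shift (x + t *: v)) (h *: v) - f (x + t *: v)).
  apply/funext => h /=; congr (_ *: (f _ - _)).
  by rewrite scalerDl [h *: 1]mulr1 addrCA addrA.
by split; rewrite /derivable /derive eqf; [exact: df|].
Qed.

Lemma mean_value_line f x v (c : R) : (forall y, derivable f y v) ->
  exists2 t, `|t| <= `|c| & f (x + c *: v) - f x = 'D_v f (x + t *: v) * c.
Proof.
move=> df; pose phi s := f (x + s *: v).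
have dphi s : is_derive s (1 : R) phi ('D_v f (x + s *: v)) by exact: is_derive_line.
have cphi a b : {within `[a, b], continuous phi}.
  apply: continuous_subspaceT => s.
  by apply/differentiable_continuous/derivable1_diffP; have [] := dphi s.
have [c0|c0] := leP 0 c.
  have [t] := MVT_segment c0 (fun s _ => dphi s) (cphi 0 c).
  rewrite in_itv/= => /andP[t0 tc]; rewrite /phi scale0r addr0 subr0 => ->.
  by exists t; rewrite // !ger0_norm.
have [t] := MVT_segment (ltW c0) (fun s _ => dphi s) (cphi c 0).
rewrite in_itv/= => /andP[t0 tc]; rewrite /phi scale0r addr0 sub0r => eqt.
exists t; first by rewrite (ltr0_norm c0) ler0_norm// lerN2.
by rewrite -opprB eqt; ring.
Qed.

(** Telescoping along a path parallel to the axes uses partial derivatives only. Each intermediate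
    point differs from x by a vector dominated coordinatewise by xi. *)
Lemma mean_value_coord f x xi :
  (forall y i, derivable f y (delta_mx 0 i)) ->
  exists2 z : 'I_n -> 'rV[R]_n, forall i, enorm (z i - x) <= enorm xi &
    f (x + xi) - f x = \sum_i 'D_(delta_mx 0 i) f (z i) * xi 0 i.
Proof.
move=> df.
pose y k : 'rV[R]_n := x + \row_i (if (i < k)%N then xi 0 i else 0).
have yS (i : 'I_n) : y i.+1 = y i + xi 0 i *: delta_mx 0 i.
  apply/rowP => j; rewrite !mxE -addrA; congr (_ + _); rewrite ltnS leq_eqVlt.
  have [->|ji] := eqVneq j i; first by rewrite !eqxx ltnn/= mulr1 add0r.
  have -> : (j == i :> nat) = false by apply/negbTE.
  by rewrite andbF mulr0 addr0.
have /choice[t tP] (i : 'I_n) : exists t, `|t| <= `|xi 0 i| /\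
    f (y i.+1) - f (y i) = 'D_(delta_mx 0 i) f (y i + t *: delta_mx 0 i) * xi 0 i.
  have [t ? ?] := @mean_value_line f (y i) (delta_mx 0 i) (xi 0 i) (fun z => df z i).
  by exists t; rewrite yS.
exists (fun i : 'I_n => y i + t i *: delta_mx 0 i) => [i|].
  rewrite -ler_sqr ?nnegrE ?enorm_ge0// !sqr_enorm; apply: ler_sum => j _.
  rewrite -!expr2 -[leLHS]real_normK ?num_real// -[leRHS]real_normK ?num_real//.
  rewrite ler_sqr ?nnegrE//.
  have -> : (y i + t i *: delta_mx 0 i - x) 0 j =
      (if (j < i)%N then xi 0 j else 0) + t i * (j == i)%:R.
    by rewrite /y !mxE eqxx/=; ring.
  have [->|ji] := eqVneq j i; last by rewrite mulr0 addr0; case: ifP; rewrite ?normr0.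
  by rewrite ltnn add0r mulr1; have [] := tP i.
under eq_bigr do rewrite -(proj2 (tP _)).
rewrite -(big_mkord xpredT (fun i => f (y i.+1) - f (y i))) telescope_sumr//.
congr (f _ - f _); apply/rowP => j; rewrite !mxE ?ltn_ord//.
by rewrite ltn0 addr0.
Qed.

Lemma Zperiodic_derive f v : Zperiodic f -> Zperiodic (fun x => 'D_v f x).
Proof.
move=> pf k x; rewrite /derive.
suff -> : (fun h : R => h^-1 *: ((f \o shift (x + map_mx intr k)) (h *: v) -
      f (x + map_mx intr k))) = fun h => h^-1 *: ((f \o shift x) (h *: v) - f x) by [].
by apply/funext => h /=; rewrite addrA !pf.
Qed.

Lemma Zperiodic_Ck1_lipschitz f : Zperiodic f -> Ck 1 f ->
  exists2 K, 0 <= K & forall x xi, `|f (x + xi) - f x| <= K * enorm xi.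
Proof.
move=> pf [cf df].
have /choice[B BP] (i : 'I_n) : exists B, 0 <= B /\
    forall x, `|'D_(delta_mx 0 i) f x| <= B.
  have [B B0 BP] := Zperiodic_bounded (Zperiodic_derive (delta_mx 0 i) pf) (proj2
    (df i)).
  by exists B.
exists (\sum_i B i) => [|x xi]; first by apply: sumr_ge0 => i _; have [] := BP i.
have [z _ ->] := @mean_value_coord f x xi (fun y i => proj1 (df i) y).
rewrite mulr_suml; apply: (le_trans (ler_norm_sum _ _ _)); apply: ler_sum => i _.
by rewrite normrM; apply: ler_pM => //; [exact: (proj2 (BP i))|exact: normr_coord_le].
Qed.

(** The partial derivatives are Lipschitz by [Zperiodic_Ck1_lipschitz], so replacing their values at
    the intermediate points [z i] by those at x costs O(|xi|^2). *)
Lemma Zperiodic_Ck2_taylor1 f : Zperiodic f -> Ck 2 f -> taylor1 f.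
Proof.
move=> pf [cf df]; have [B B0 fB] := Zperiodic_bounded pf cf.
have pdf i := Zperiodic_derive (delta_mx 0 i : 'rV[R]_n) pf.
have /choice[L LP] (i : 'I_n) : exists L, 0 <= L /\ forall x xi,
    `|'D_(delta_mx 0 i) f (x + xi) - 'D_(delta_mx 0 i) f x| <= L * enorm xi.
  by have [L ? ?] := Zperiodic_Ck1_lipschitz (pdf i) (proj2 (df i)); exists L.
have /choice[C CP] (i : 'I_n) : exists C, 0 <= C /\
    forall x, `|'D_(delta_mx 0 i) f x| <= C.
  by have [C ? ?] := Zperiodic_bounded (pdf i) (proj1 (proj2 (df i))); exists C.
have sL : 0 <= \sum_i L i by apply: sumr_ge0 => i _; have [] := LP i.
have sC : 0 <= \sum_i C i by apply: sumr_ge0 => i _; have [] := CP i.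
exists (B + n%:R * \sum_i C i + \sum_i L i) => [|x].
  by rewrite !addr_ge0// mulr_ge0.
split; first by apply: (le_trans (fB x)); rewrite -addrA lerDl addr_ge0// mulr_ge0.
exists (\row_i 'D_(delta_mx 0 i) f x) => [|xi].
  apply: (le_trans (enorm_le_normr _)).
  apply: (@le_trans _ _ (n%:R * \sum_i C i)); last by rewrite addrAC lerDr addr_ge0.
  rewrite ler_wpM2l// [leLHS]/Num.norm/= mx_normrE.
  apply: bigmax_le => // -[i j] _ /=; rewrite !mxE.
  rewrite (bigD1 j)//= -[leLHS]addr0; apply: lerD; first exact: (proj2 (CP j)).
  by apply: sumr_ge0 => k _; have [] := CP k.
have [z zx ->] := @mean_value_coord f x xi (fun y i => proj1 (df i) y).
rewrite /dot -sumrB; apply: (@le_trans _ _ ((\sum_i L i) * enorm xi ^+ 2)); last first.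
  by rewrite ler_wpM2r ?sqr_ge0// lerDr addr_ge0// mulr_ge0.
rewrite mulr_suml; apply: (le_trans (ler_norm_sum _ _ _)); apply: ler_sum => i _.
rewrite mxE -mulrBl normrM expr2 mulrA; apply: ler_pM => //; last exact: normr_coord_le.
have := proj2 (LP i) x (z i - x); rewrite [x + _]addrC subrK => /le_trans; apply.
by rewrite ler_wpM2l//; have [] := LP i.
Qed.

End Taylor.

(** * Supergradients of semiconcave functions *)

Section Semiconcave.
Context {R : realType} {n : nat}.
Implicit Types (x y p q v xi : 'rV[R]_n) (f : 'rV[R]_n -> R) (C : R).

Lemma sqr_enormD p q :
  enorm (p + q) ^+ 2 = enorm p ^+ 2 + 2 * dot p q + enorm q ^+ 2.
Proof. by rewrite !sqr_enorm !(dotDl, dotDr) (dotC q p); ring. Qed.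

Lemma sqr_enormB p q :
  enorm (p - q) ^+ 2 = enorm p ^+ 2 - 2 * dot p q + enorm q ^+ 2.
Proof. by rewrite sqr_enormD dotNr enormN; ring. Qed.

(** The second difference form of semiconcavity; C is half of the usual constant. *)
Definition midsc f C : Prop :=
  forall x xi, f (x + xi) + f (x - xi) <= 2 * f x + 2 * C * enorm xi ^+ 2.

(** Proximal supergradients with prescribed constant and unlimited range: a family of inequalities
    affine in p, equivalent to [superdiff] under [midsc] (see [superdiffP]). *)
Definition prox f C x p : Prop :=
  forall xi, f (x + xi) <= f x + dot p xi + C * enorm xi ^+ 2.

Lemma semiconcave_midsc f : semiconcave setT f -> exists2 C, 0 < C & midsc f C.
Proof.
move=> [C C0 cf]; exists (C / 2) => [|x xi]; first by rewrite divr_gt0.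
have h01 : 0 <= (2^-1 : R) <= 1 by lra.
case/andP: h01 => h0 h1.
pose F z := - (f z - C / 2 * dot z z).
have : F (2^-1 *: (x + xi) + (1 - 2^-1) *: (x - xi)) <=
    2^-1 * F (x + xi) + (1 - 2^-1) * F (x - xi).
  by apply: (cf (Itv01 h0 h1)); rewrite inE.
have -> : 2^-1 *: (x + xi) + (1 - 2^-1) *: (x - xi) = x :> 'rV[R]_n.
  have -> : 1 - 2^-1 = 2^-1 :> R by lra.
  rewrite -scalerDr addrACA subrr addr0 scalerDr -scalerDl.
  by rewrite (_ : 2^-1 + 2^-1 = 1) ?scale1r; last by lra.
rewrite /F -!sqr_enorm (sqr_enormD x xi) (sqr_enormB x xi); lra.
Qed.

(** For the defect h, [midsc] at x + z / 2 gives h z <= 2 h (z / 2). Iterating, h xi <= 2^k h (xi /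
    2^k), whose limsup is nonpositive because h z <= o(|z|). *)
Lemma prox_of_superdiff f C x p : midsc f C ->
  (forall e, 0 < e -> exists2 d, 0 < d & forall xi, enorm xi < d ->
     f (x + xi) <= f x + dot p xi + e * enorm xi) ->
  prox f C x p.
Proof.
move=> fC fp xi.
pose h xi := f (x + xi) - f x - dot p xi - C * enorm xi ^+ 2.
suff : h xi <= 0 by rewrite /h; lra.
have h2 z : h z <= 2 * h (2^-1 *: z).
  have := fC (x + 2^-1 *: z) (2^-1 *: z).
  rewrite addrK -addrA -scalerDl (_ : 2^-1 + 2^-1 = 1) ?scale1r; last by lra.
  rewrite /h dotZr enormZ exprMn real_normK ?num_real//; lra.
have hk k : h xi <= 2 ^+ k * h (2^-1 ^+ k *: xi).
  elim: k => [|k IH]; first by rewrite !expr0 mul1r scale1r.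
  apply: (le_trans IH); rewrite exprSr -mulrA ler_wpM2l ?exprn_ge0//.
  by rewrite exprS -scalerA.
rewrite leNgt; apply/negP => h0.
have xi0 : xi != 0.
  apply/eqP => xi0; move: h0.
  by rewrite /h xi0 addr0 subrr dot0r enorm0 expr0n mulr0 !subr0 ltxx.
have n0 : 0 < enorm xi by rewrite enorm_gt0.
have [d d0 dP] := fp (h xi / (4 * enorm xi)) (divr_gt0 h0 (mulr_gt0 (ltr0n _ 4) n0)).
(* 2^k > m makes xi / 2^k shorter than d and the quadratic term smaller than h xi / 4; the error in
   [dP] accounts for another quarter. *)
pose m := Num.max (enorm xi / d) (4 * `|C| * enorm xi ^+ 2 / h xi).
have [k km] : exists k : nat, m < 2 ^+ k.
  exists (Num.bound m); apply: (lt_trans (archi_boundP _)).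
    by rewrite le_max divr_ge0// ltW.
  by rewrite -natrX ltr_nat ltn_expl.
have P0 : 0 < 2 ^+ k :> R by rewrite exprn_gt0.
move: km; rewrite gt_max => /andP[]; rewrite ltr_pdivrMr// => kd;
  rewrite ltr_pdivrMr// => kC.
have small : (2 ^+ k)^-1 * enorm xi < d.
  by rewrite mulrC ltr_pdivrMr// mulrC.
have := dP (2^-1 ^+ k *: xi); rewrite exprVn enormZ.
rewrite ger0_norm ?invr_ge0 ?(ltW P0)// => /(_ small).
have := hk k; rewrite exprVn /h enormZ ger0_norm ?invr_ge0 ?(ltW P0)//.
set P := 2 ^+ k in P0 kd kC *; set F := f (x + P^-1 *: xi).
rewrite dotZr exprMn -/(h xi) => h3 h4.
have : P * (F - f x - P^-1 * dot p xi) <= h xi / 4.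
  rewrite -ler_pdivlMl//;
    apply: (@le_trans _ _ (h xi / (4 * enorm xi) * (P^-1 * enorm xi))).
    by lra.
  by rewrite le_eqVlt; apply/orP; left; apply/eqP; field; rewrite !gt_eqF.
have : - (P * (C * (P^-1 ^+ 2 * enorm xi ^+ 2))) < h xi / 4.
  have -> : P * (C * (P^-1 ^+ 2 * enorm xi ^+ 2)) = P^-1 * (C * enorm xi ^+ 2).
    by field; rewrite gt_eqF.
  rewrite -mulrN mulrC ltr_pdivrMr//.
  have : - (C * enorm xi ^+ 2) <= `|C| * enorm xi ^+ 2.
    by rewrite -mulNr ler_wpM2r ?sqr_ge0// -normrN ler_norm.
  by move: kC; rewrite mulrC; lra.
by move: h3; rewrite !mulrBr; lra.
Qed.

Lemma prox_of_quadratic f C M x p : midsc f C -> prox f M x p -> prox f C x p.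
Proof.
move=> fC fM; apply: prox_of_superdiff fC _ => e e0.
exists (e / (`|M| + 1)) => [|xi]; first by rewrite divr_gt0// ltr_wpDl.
rewrite ltr_pdivlMr ?ltr_wpDl// => xie; apply: (le_trans (fM xi)); rewrite lerD2l.
rewrite expr2 mulrA ler_wpM2r ?enorm_ge0//; apply: le_trans (ltW xie).
rewrite mulrC ler_wpM2l ?enorm_ge0//.
by apply: (le_trans (ler_norm _)); rewrite lerDl.
Qed.

(** Reflecting xi to - xi in [midsc] turns the lower paraboloid into an upper one with constant 2 C
    + M, which [prox_of_quadratic] improves to C. *)
Lemma prox_of_touching_below f C M x p : midsc f C ->
  (forall xi, f x + dot p xi - M * enorm xi ^+ 2 <= f (x + xi)) -> prox f C x p.
Proof.
move=> fC fM; apply: (@prox_of_quadratic _ _ (2 * C + M) _ _ fC) => xi.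
have := fC x xi; have := fM (- xi); rewrite dotNr enormN; lra.
Qed.

Lemma superdiffP f C x p : midsc f C -> superdiff f x p <-> prox f C x p.
Proof.
move=> fC; split=> [fp|fp].
  apply: prox_of_superdiff fC _ => e e0.
  have /ereal_inf_lt[_ [A xA <-]] : (limf_esup (fun y =>
      ((f y - f x - dot p (y - x)) / enorm (y - x))%:E) x^' < e%:E)%E.
    by apply: le_lt_trans fp _; rewrite lte_fin.
  move=> Ae; have /nbhs_enormP[d d0 dA] := xA; exists d => // xi xid.
  have [->|xi0] := eqVneq xi 0; first by rewrite addr0 dot0r enorm0 mulr0 !addr0.
  have xxi : x + xi - x = xi by rewrite addrAC subrr add0r.
  have {}dA : A (x + xi) by apply: dA; rewrite ?xxi// -subr_eq0 xxi.
  have /ltW := le_lt_trans (ereal_sup_ubound (imageP _ dA)) Ae.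
  rewrite lee_fin xxi ler_pdivrMr ?enorm_gt0//; lra.
apply/lee_addgt0Pr => e e0; rewrite add0e.
pose A : set 'rV[R]_n := [set y | y != x /\ C * enorm (y - x) <= e].
apply: (@le_trans _ _ (ereal_sup ((fun y =>
      ((f y - f x - dot p (y - x)) / enorm (y - x))%:E) @` A))).
  apply: ereal_inf_lbound; exists A => //; apply/nbhs_enormP.
  exists (e / (`|C| + 1)) => [|y]; first by rewrite divr_gt0// ltr_wpDl.
  rewrite ltr_pdivlMr ?ltr_wpDl// => yx yn; split=> //; apply: le_trans (ltW yx).
  rewrite mulrC ler_wpM2l ?enorm_ge0//.
  by apply: (le_trans (ler_norm _)); rewrite lerDl.
apply: ge_ereal_sup => _ [y [yx ye] <-]; rewrite lee_fin.
rewrite ler_pdivrMr ?enorm_gt0 ?subr_eq0//.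
have := fp (y - x); rewrite [x + _]addrC subrK.
have : C * enorm (y - x) * enorm (y - x) <= e * enorm (y - x).
  by rewrite ler_wpM2r ?enorm_ge0.
rewrite expr2; lra.
Qed.

Lemma subdiff_of_touching_below f M x p :
  (forall xi, f x + dot p xi - M * enorm xi ^+ 2 <= f (x + xi)) -> subdiff f x p.
Proof.
move=> fp; rewrite /subdiff/= /limf_einf leeNr oppe0.
apply/lee_addgt0Pr => e e0; rewrite add0e.
pose A : set 'rV[R]_n := [set y | y != x /\ M * enorm (y - x) <= e].
apply: (@le_trans _ _ (ereal_sup ((fun y =>
      (- ((f y - f x - dot p (y - x)) / enorm (y - x))%:E)%E) @` A))).
  apply: ereal_inf_lbound; exists A => //; apply/nbhs_enormP.
  exists (e / (`|M| + 1)) => [|y]; first by rewrite divr_gt0// ltr_wpDl.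
  rewrite ltr_pdivlMr ?ltr_wpDl// => yx yn; split=> //; apply: le_trans (ltW yx).
  rewrite mulrC ler_wpM2l ?enorm_ge0//.
  by apply: (le_trans (ler_norm _)); rewrite lerDl.
apply: ge_ereal_sup => _ [y [yx ye] <-]; rewrite -EFinN lee_fin -mulNr.
rewrite ler_pdivrMr ?enorm_gt0 ?subr_eq0//.
have := fp (y - x); rewrite [x + _]addrC subrK.
have : M * enorm (y - x) * enorm (y - x) <= e * enorm (y - x).
  by rewrite ler_wpM2r ?enorm_ge0.
rewrite expr2; lra.
Qed.

Lemma penalized_min f B M y : continuous f -> (forall x, `|f x| <= B) -> 0 < M ->
  exists x, forall z,
    f x + M * enorm (x - y) ^+ 2 <= f z + M * enorm (z - y) ^+ 2.
Proof.
move=> cf fB M0; have B0 : 0 <= B := le_trans (normr_ge0 _) (fB 0).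
(* Outside radius r >= 1 the penalty is at least M r = 2 B + M, more than the oscillation of f. *)
pose r := 2 * B / M + 1.
have r1 : 1 <= r by rewrite lerDr divr_ge0 ?mulr_ge0// ltW.
pose F x := f x + M * enorm (x - y) ^+ 2.
have cF : continuous F.
  move=> x; apply: (@continuousD _ _ _ f (fun x => M * enorm (x - y) ^+ 2)).
    exact: cf.
  apply: (@continuousM _ _ (fun=> M) (fun x => enorm (x - y) ^+ 2)).
    exact: cst_continuous.
  exact: continuous_sqr_enormB.
have [||x _ xF] := @compact_EVT_min _ _ F _ _ (@compact_enorm_ball R n y r).
- by exists y; rewrite /= subrr enorm0 (le_trans _ r1).
- exact: continuous_subspaceT.
exists x => z; have [zr|zr] := leP (enorm (z - y)) r.
  by apply: xF; rewrite inE.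
have : F x <= F y by apply: xF; rewrite inE /= subrr enorm0 (le_trans _ r1).
rewrite /F subrr enorm0 expr0n mulr0 addr0 => /le_trans; apply.
have zr2 : r <= enorm (z - y) ^+ 2.
  have zr1 := le_trans r1 (ltW zr).
  by rewrite expr2 -[leLHS]mulr1; apply: ler_pM; rewrite ?(ltW zr)//; lra.
have : M * r <= M * enorm (z - y) ^+ 2 by rewrite ler_wpM2l// ltW.
have -> : M * r = 2 * B + M by rewrite /r; field; rewrite gt_eqF.
by have := fB z; have := fB y; rewrite !ler_norml => /andP[? ?] /andP[? ?]; lra.
Qed.

(** A minimiser of f + M |. - y|^2 is touched from below; as M e^2 = 2 B + 1 exceeds the oscillation
    of f, it stays within e of y. *)
Lemma touching_below_dense f B y e : continuous f -> (forall x, `|f x| <= B) ->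
  0 < e -> exists x p M, enorm (x - y) <= e /\
    forall xi, f x + dot p xi - M * enorm xi ^+ 2 <= f (x + xi).
Proof.
move=> cf fB e0; have B0 : 0 <= B := le_trans (normr_ge0 _) (fB 0).
pose M := (2 * B + 1) / e ^+ 2.
have M0 : 0 < M by rewrite divr_gt0 ?exprn_gt0// ltr_wpDl// mulr_ge0.
have [x xP] := penalized_min y cf fB M0.
exists x, ((- 2 * M) *: (x - y)), M; split=> [|xi].
  have := xP y; rewrite subrr enorm0 expr0n mulr0 addr0 => xy.
  rewrite leNgt; apply/negP => ex.
  have : M * e ^+ 2 <= M * enorm (x - y) ^+ 2.
    by rewrite ler_wpM2l ?(ltW M0)// ler_sqr ?nnegrE ?enorm_ge0 ?ltW.
  have -> : M * e ^+ 2 = 2 * B + 1 by rewrite /M; field; rewrite gt_eqF.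
  by have := fB x; have := fB y; rewrite !ler_norml => /andP[? ?] /andP[? ?]; lra.
have := xP (x + xi); rewrite addrAC (sqr_enormD (x - y)) dotZl; lra.
Qed.

Lemma prox_closed f C (xs ps : nat -> 'rV[R]_n) x p : continuous f -> 0 <= C ->
  (forall k, prox f C (xs k) (ps k)) ->
  (forall e, 0 < e -> exists k, enorm (xs k - x) <= e /\ enorm (ps k - p) <= e) ->
  prox f C x p.
Proof.
move=> cf C0 fp cvg xi; apply/ler_addgt0Pr => e e0.
(* Besides the e / 2 from continuity, replacing [xs k], [ps k] by x, p costs at most r N. *)
pose N := 1 + enorm xi + enorm p + C * (1 + 2 * enorm xi).
have N0 : 0 < N.
  by rewrite !ltr_wpDr ?enorm_ge0 ?mulr_ge0 ?addr_ge0 ?enorm_ge0 ?mulr_ge0 ?enorm_ge0.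
have [d d0 dP] := (proj1 (continuous_enormP f) cf) x (e / 2) (divr_gt0 e0 (ltr0n _ 2)).
pose r := Num.min (Num.min (d / 2) 1) (e / (2 * (N + 1))).
have N1 : 0 < 2 * (N + 1) by rewrite mulr_gt0// addr_gt0.
have r0 : 0 < r by rewrite !lt_min !divr_gt0// ltr01.
have [k [xk pk]] := cvg r r0.
have rd : r < d.
  by apply: (@le_lt_trans _ _ (d / 2)); [rewrite !ge_min lexx|lra].
have r1 : r <= 1 by rewrite !ge_min lexx orbT.
have re : r * (2 * (N + 1)) <= e.
  by rewrite -ler_pdivlMr// /r !ge_min lexx !orbT.
have := fp k (x + xi - xs k); rewrite [xs k + _]addrC subrK.
have := dP (xs k) (le_lt_trans xk rd); rewrite ltr_norml => /andP[_ fk].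
set z := xs k - x in xk; set q := ps k - p in pk.
have -> : x + xi - xs k = xi - z by rewrite /z opprB addrA [xi + x]addrC.
have -> : ps k = p + q by rewrite /q addrC subrK.
rewrite sqr_enormB dotDl (dotBr xi z p) (dotBr xi z q) => fx.
have := dot_le q xi; have := dot_le (- p) z; have := dot_le (- q) z.
have := dot_le (- xi) z.
rewrite !dotNl !enormN.
have e1 := enorm_ge0 xi; have e2 := enorm_ge0 p.
have e3 := enorm_ge0 z; have e4 := enorm_ge0 q.
have m1 : enorm q * enorm xi <= r * enorm xi by rewrite ler_wpM2r.
have m2 : enorm p * enorm z <= r * enorm p by rewrite mulrC ler_wpM2r.
have m3 : enorm q * enorm z <= r.
  by rewrite -[leRHS]mulr1; apply: ler_pM => //; exact: le_trans xk r1.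
have m4 : C * enorm z ^+ 2 <= C * r.
  rewrite ler_wpM2l// expr2 -[leRHS]mulr1; apply: ler_pM => //; exact: le_trans xk r1.
have m5 : C * (enorm xi * enorm z) <= C * (enorm xi * r).
  by rewrite ler_wpM2l// ler_wpM2l.
move=> d1 d2 d3 d4.
have m6 : C * (- dot xi z) <= C * (enorm xi * enorm z) by rewrite ler_wpM2l.
have : r * N = r + r * enorm xi + r * enorm p + C * r + 2 * (C * (enorm xi * r)).
  by rewrite /N; ring.
have : 2 * (r * N) + 2 * r <= e by move: re; lra.
move: (r * N) => rN; lra.
Qed.

End Semiconcave.

(** * Riemannian metrics and their duals *)

Section RegularMetric.
Context {R : realType} {n : nat}.
Implicit Types (x y z p q v xi : 'rV[R]_n).

(** a acts on covectors and b = a^-1 on vectors; one K serves for all bounds. The expansion of b is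
    one-sided: semiconcavity of the distance rests on upper bounds for lengths. *)
Record regular_metric (a b : 'rV[R]_n -> 'M[R]_n) (K : R) : Prop := RegularMetric {
  metric_K : 1 <= K;
  cometric_psd : forall x, psdmx (a x);
  metric_psd : forall x, psdmx (b x);
  metric_inv : forall x, a x *m b x = 1%:M;
  cometric_ub : forall x p, bform (a x) p p <= K * enorm p ^+ 2;
  metric_ub : forall x v, bform (b x) v v <= K * enorm v ^+ 2;
  cometric_lip : forall x y p,
    `|bform (a y) p p - bform (a x) p p| <= K * enorm (y - x) * enorm p ^+ 2;
  metric_lip : forall x y v w,
    `|bform (b y) v w - bform (b x) v w| <= K * enorm (y - x) * enorm v * enorm w;
  metric_taylor : forall x v, exists g, forall xi,
    bform (b (x + xi)) v v <=
      bform (b x) v v + dot g xi + K * enorm xi ^+ 2 * enorm v ^+ 2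
}.

Lemma bformE (M : 'M[R]_n) p q :
  bform M p q = \sum_i \sum_j p 0 i * M i j * q 0 j.
Proof.
rewrite /bform /dot exchange_big/=; apply: eq_bigr => j _.
by rewrite mxE mulr_suml.
Qed.

Lemma normr_bform_le (M : 'M[R]_n) p q e : (forall i j, `|M i j| <= e) ->
  `|bform M p q| <= (n ^ 2)%:R * e * enorm p * enorm q.
Proof.
move=> Me; rewrite bformE.
have -> : (n ^ 2)%:R * e * enorm p * enorm q =
    \sum_(i < n) \sum_(j < n) enorm p * e * enorm q.
  by rewrite !sumr_const !card_ord -mulrnA mulnn -[RHS]mulr_natl; ring.
apply: (le_trans (ler_norm_sum _ _ _)); apply: ler_sum => i _.
apply: (le_trans (ler_norm_sum _ _ _)); apply: ler_sum => j _.
rewrite !normrM; apply: ler_pM; rewrite ?mulr_ge0// ?normr_coord_le//.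
by apply: ler_pM; rewrite ?normr_coord_le.
Qed.

Lemma bformBm (M N : 'M[R]_n) p q : bform (M - N) p q = bform M p q - bform N p q.
Proof. by rewrite /bform mulmxBr dotBl. Qed.

Lemma taylor1_form_bounds (F : 'rV[R]_n -> 'M[R]_n) :
  (forall i j, taylor1 (fun x => F x i j)) ->
  exists2 K, 0 <= K & [/\
    forall x p, bform (F x) p p <= K * enorm p ^+ 2,
    forall x y v w, `|bform (F y) v w - bform (F x) v w|
      <= K * enorm (y - x) * enorm v * enorm w &
    forall x v, exists g, forall xi, bform (F (x + xi)) v v <=
      bform (F x) v v + dot g xi + K * enorm xi ^+ 2 * enorm v ^+ 2].
Proof.
move=> TF.
(* Finitely many entries: the sum of their constants serves for all of them. *)
have unif (P : 'I_n -> 'I_n -> R -> Prop) : (forall i j, exists2 e, 0 <= e & P i j e) ->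
    (forall i j e e', e <= e' -> P i j e -> P i j e') ->
    exists2 e, 0 <= e & forall i j, P i j e.
  move=> Pex Pmono.
  have /choice[e eP] (ij : 'I_n * 'I_n) : exists e, 0 <= e /\ P ij.1 ij.2 e.
    by have [e ? ?] := Pex ij.1 ij.2; exists e.
  exists (\sum_ij e ij) => [|i j].
    by apply: sumr_ge0 => ij _; have [] := eP ij.
  apply: (Pmono _ _ (e (i, j))); last by have [] := eP (i, j).
  rewrite (bigD1 (i, j))//= lerDl; apply: sumr_ge0 => ij _.
  by have [] := eP ij.
have [B B0 BP] : exists2 e, 0 <= e & forall i j, forall x, `|F x i j| <= e.
  apply: unif => [i j|i j e e' ee' h x]; last exact: le_trans ee'.
  by have [K K0 KP] := TF i j; exists K => // x; have [] := KP x.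
have [J J0 JP] : exists2 e, 0 <= e & forall i j, forall x xi,
    `|F (x + xi) i j - F x i j| <= e * enorm xi.
  apply: unif => [i j|i j e e' ee' h x xi]; first exact: taylor1_lipschitz (TF i j).
  by apply: (le_trans (h x xi)); rewrite ler_wpM2r ?enorm_ge0.
have [T T0 TP] : exists2 e, 0 <= e & forall i j, forall x, exists g, forall xi,
    `|F (x + xi) i j - F x i j - dot g xi| <= e * enorm xi ^+ 2.
  apply: unif => [i j|i j e e' ee' h x].
    have [K K0 KP] := TF i j; exists K => // x.
    by have [_ [g _ ?]] := KP x; exists g.
  have [g gP] := h x; exists g => xi; apply: (le_trans (gP xi)).
  by rewrite ler_wpM2r ?sqr_ge0.
have n20 : 0 <= (n ^ 2)%:R :> R by [].
exists ((n ^ 2)%:R * (B + J + T)); first by rewrite mulr_ge0// !addr_ge0.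
split=> [x p|x y v w|x v].
- apply: (le_trans (ler_norm _)).
  apply: (le_trans (normr_bform_le p p (fun i j => BP i j x))).
  rewrite expr2 mulrA; do 2!rewrite ler_wpM2r ?enorm_ge0//.
  by rewrite ler_wpM2l// -addrA lerDl addr_ge0.
- rewrite -bformBm; apply: (@le_trans _ _ ((n ^ 2)%:R * (J * enorm (y - x)) *
      enorm v * enorm w)).
    apply: normr_bform_le => i j; rewrite !mxE.
    by have := JP i j x (y - x); rewrite [x + _]addrC subrK.
  do 2!rewrite ler_wpM2r ?enorm_ge0//; rewrite mulrA ler_wpM2r ?enorm_ge0//.
  by rewrite ler_wpM2l// addrAC lerDr addr_ge0.
have /choice[g gP] (ij : 'I_n * 'I_n) : exists g, forall xi,
    `|F (x + xi) ij.1 ij.2 - F x ij.1 ij.2 - dot g xi| <= T * enorm xi ^+ 2.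
  exact: TP.
pose G xi : 'M[R]_n := \matrix_(i, j) dot (g (i, j)) xi.
exists (\sum_i \sum_j (v 0 i * v 0 j) *: g (i, j)) => xi.
have -> : dot (\sum_i \sum_j (v 0 i * v 0 j) *: g (i, j)) xi = bform (G xi) v v.
  rewrite bformE (big_morph (fun p => dot p xi) (fun p q => dotDl p q xi) (dot0l xi)).
  apply: eq_bigr => i _.
  rewrite (big_morph (fun p => dot p xi) (fun p q => dotDl p q xi) (dot0l xi)).
  by apply: eq_bigr => j _; rewrite dotZl mxE mulrAC.
rewrite -lerBlDl opprD addrA.
have -> : bform (F (x + xi)) v v - bform (F x) v v - bform (G xi) v v =
    bform (F (x + xi) - F x - G xi) v v by rewrite !bformBm.
apply: (le_trans (ler_norm _)); apply: (le_trans (normr_bform_le v v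
  (e := T * enorm xi ^+ 2) _)) => [i j|]; first by rewrite !mxE; exact: (gP (i, j)).
rewrite [enorm v ^+ 2]expr2 [leRHS]mulrA; do 2!rewrite ler_wpM2r ?enorm_ge0//.
rewrite mulrA ler_wpM2r ?sqr_ge0// ler_wpM2l//.
by rewrite lerDr addr_ge0.
Qed.

(** * Norm duality between metric and cometric *)

Section Duality.
Context (a b : 'rV[R]_n -> 'M[R]_n) (K : R) (mab : regular_metric a b K).

Let K1 : 1 <= K. Proof. by case: mab. Qed.
Let K0 : 0 < K. Proof. exact: lt_le_trans K1. Qed.

Lemma sqr_cometric x p : mnorm (a x) p ^+ 2 = bform (a x) p p.
Proof. exact: sqr_mnorm (cometric_psd mab x). Qed.

Lemma sqr_metric x v : mnorm (b x) v ^+ 2 = bform (b x) v v.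
Proof. exact: sqr_mnorm (metric_psd mab x). Qed.

Lemma metric_invC x : b x *m a x = 1%:M.
Proof. exact: mulmx1C (metric_inv mab x). Qed.

(** [v *m b x] is the covector dual to v, and [p *m a x] the vector dual to p. These maps are
    isometries, so that Cauchy-Schwarz for a becomes the duality of the two norms. *)
Lemma dot_metric x p v : dot p v = bform (a x) p (v *m b x).
Proof.
have [syma _] := cometric_psd mab x.
by rewrite /bform dot_mulmx syma -mulmxA metric_invC mulmx1.
Qed.

Lemma mnorm_flat x v : mnorm (a x) (v *m b x) = mnorm (b x) v.
Proof.
by congr Num.sqrt; rewrite /bform -mulmxA metric_invC mulmx1 dotC.
Qed.

Lemma mnorm_sharp x p : mnorm (b x) (p *m a x) = mnorm (a x) p.
Proof.
by congr Num.sqrt; rewrite /bform -mulmxA (metric_inv mab) mulmx1 dotC.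
Qed.

Lemma dot_sharp x p : dot p (p *m a x) = mnorm (a x) p ^+ 2.
Proof. by rewrite sqr_cometric /bform dotC. Qed.

Lemma dot_le_metric x p v : dot p v <= mnorm (a x) p * mnorm (b x) v.
Proof.
rewrite (dot_metric x) -(mnorm_flat x v); apply: (le_trans (ler_norm _)).
exact: bform_le_mnorm (cometric_psd mab x).
Qed.

Let sqrle (s t : R) : 0 <= s -> 0 <= t -> s ^+ 2 <= t ^+ 2 -> s <= t.
Proof. by move=> s0 t0; rewrite ler_sqr. Qed.

Let K2 (s : R) : 0 <= s -> K * s <= K ^+ 2 * s.
Proof. by move=> s0; rewrite ler_wpM2r// expr2 ler_peMl// ltW. Qed.

Lemma mnorm_metric_le x v : mnorm (b x) v <= K * enorm v.
Proof.
apply: sqrle; rewrite ?mnorm_ge0 ?mulr_ge0 ?enorm_ge0 ?(ltW K0)//.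
rewrite sqr_metric exprMn.
by apply: (le_trans (metric_ub mab x v)); rewrite K2 ?sqr_ge0.
Qed.

Lemma mnorm_cometric_le x p : mnorm (a x) p <= K * enorm p.
Proof.
apply: sqrle; rewrite ?mnorm_ge0 ?mulr_ge0 ?enorm_ge0 ?(ltW K0)//.
rewrite sqr_cometric exprMn.
by apply: (le_trans (cometric_ub mab x p)); rewrite K2 ?sqr_ge0.
Qed.

(** Pair v with itself in [dot_le_metric]: the lower bound for b comes from the upper bound for
    a. *)
Lemma enorm_le_metric x v : enorm v <= K * mnorm (b x) v.
Proof.
have [->|v0] := eqVneq v 0; first by rewrite enorm0 mulr_ge0 ?mnorm_ge0// ltW.
have e0 : 0 < enorm v by rewrite enorm_gt0.
rewrite -(ler_pM2l e0) -expr2 sqr_enorm (le_trans (dot_le_metric x v v))//.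
by rewrite mulrCA mulrA ler_wpM2r ?mnorm_ge0// mnorm_cometric_le.
Qed.

Lemma enorm_le_cometric x p : enorm p <= K * mnorm (a x) p.
Proof.
have [->|p0] := eqVneq p 0; first by rewrite enorm0 mulr_ge0 ?mnorm_ge0// ltW.
have e0 : 0 < enorm p by rewrite enorm_gt0.
rewrite -(ler_pM2l e0) -expr2 sqr_enorm (le_trans (dot_le_metric x p p))//.
by have := ler_wpM2l (mnorm_ge0 (a x) p) (mnorm_metric_le x p); lra.
Qed.

(** After squaring, the error K |x - y| |v|^2 of [metric_lip] fits into the double product once one
    factor |v| is bounded by K times the metric norm. This second K produces the K^2 to which M is
    compared below. *)
Lemma mnorm_metric_lip x y v :
  mnorm (b x) v <= mnorm (b y) v + K ^+ 2 * enorm (x - y) * enorm v.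
Proof.
have e0 := enorm_ge0 (x - y); have v0 := enorm_ge0 v.
have m0 := mnorm_ge0 (b y) v.
have k0 : 0 <= K ^+ 2 * enorm (x - y) * enorm v by rewrite !mulr_ge0// ltW.
apply: sqrle; rewrite ?mnorm_ge0 ?addr_ge0//.
rewrite sqrrD !sqr_metric.
have := le_trans (ler_norm _) (metric_lip mab y x v v).
have : K * enorm (x - y) * enorm v * enorm v <=
    K * enorm (x - y) * enorm v * (K * mnorm (b y) v).
  by rewrite ler_wpM2l ?enorm_le_metric// !mulr_ge0// ltW.
have -> : K * enorm (x - y) * enorm v * (K * mnorm (b y) v) =
  mnorm (b y) v * (K ^+ 2 * enorm (x - y) * enorm v) by ring.
have : 0 <= mnorm (b y) v * (K ^+ 2 * enorm (x - y) * enorm v) by rewrite mulr_ge0.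
have := sqr_ge0 (K ^+ 2 * enorm (x - y) * enorm v).
by rewrite mulr2n; lra.
Qed.

End Duality.
End RegularMetric.

(** * The Riemannian distance from a point *)

Section ChainDistance.
Context {R : realType} {n : nat} (a b : 'rV[R]_n -> 'M[R]_n) (K : R).
Context (mab : regular_metric a b K) (M : R) (MK : K ^+ 2 <= M) (x0 : 'rV[R]_n).
Implicit Types (x y z p q v xi : 'rV[R]_n).

Let K1 : 1 <= K. Proof. by case: mab. Qed.
Let K0 : 0 < K. Proof. exact: lt_le_trans K1. Qed.
Let M0 : 0 <= M. Proof. exact: le_trans (sqr_ge0 K) MK. Qed.

(* Cost of the straight step from [z] to [y].  It is evaluated at the endpoint [y], so
   that a supergradient of norm 1 at [y] bounds [w z - w y] by it; the quadratic term
   absorbs the variation of the metric along the step. *)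
Definition ell z y : R := mnorm (b y) (y - z) + M * enorm (y - z) ^+ 2.

(* [chain y L S]: a polygon from [x0] to [y] of total cost [L], whose steps have
   lengths adding up to [S]. *)
Inductive chain : 'rV[R]_n -> R -> R -> Prop :=
| chain_nil : chain x0 0 0
| chain_cons z L S y : chain z L S ->
    chain y (L + ell z y) (S + mnorm (b y) (y - z)).

Definition dist y : R := inf [set L | exists S, chain y L S].

Lemma ell_ge z y : mnorm (b y) (y - z) <= ell z y.
Proof. by rewrite lerDl mulr_ge0// sqr_ge0. Qed.

Lemma ell_le z y : ell z y <= K * enorm (y - z) + M * enorm (y - z) ^+ 2.
Proof. by rewrite lerD2r (mnorm_metric_le mab). Qed.

(* The Lipschitz error of [b] along the cut is absorbed because [M >= K ^+ 2]. *)
Lemma ell_cut z y t : 0 <= t <= 1 ->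
  ell z (z + t *: (y - z)) + mnorm (b y) ((1 - t) *: (y - z)) <= ell z y.
Proof.
move=> /andP[t0 t1]; set D := y - z; set x := z + t *: D.
have xz : x - z = t *: D by rewrite /x addrAC subrr add0r.
have yx : x - y = (t - 1) *: D.
  by apply/rowP => i; rewrite /x /D !mxE; ring.
have := mnorm_metric_lip mab x y D.
rewrite /ell xz yx !enormZ !mnormZ -/D (ger0_norm t0).
rewrite (@ger0_norm _ (1 - t)) ?subr_ge0// (@ler0_norm _ (t - 1)) ?subr_le0//.
move=> lipD.
have := ler_wpM2l t0 lipD.
have e0 := enorm_ge0 D.
have : K ^+ 2 * (t * (1 - t) * enorm D ^+ 2) <= M * (t * (1 - t) * enorm D ^+ 2).
  by rewrite ler_wpM2r// !mulr_ge0 ?subr_ge0.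
have : 0 <= M * ((1 - t) * enorm D ^+ 2).
  by rewrite !mulr_ge0 ?subr_ge0.
have -> : t * (mnorm (b y) D + K ^+ 2 * (- (t - 1) * enorm D) * enorm D) =
  t * mnorm (b y) D + K ^+ 2 * (t * (1 - t) * enorm D ^+ 2) by ring.
rewrite exprMn; lra.
Qed.

Lemma chain_ge0 y L S : chain y L S -> 0 <= S <= L.
Proof.
elim=> [|z L' S' y' _ /andP[S0 SL]]; first by rewrite lexx.
by rewrite addr_ge0 ?mnorm_ge0//= lerD// ell_ge.
Qed.

Lemma chain_enorm y L S : chain y L S -> enorm (y - x0) <= K * S.
Proof.
elim=> [|z L' S' y' _ IH]; first by rewrite subrr enorm0 mulr0.
have -> : y' - x0 = (z - x0) + (y' - z) by rewrite [RHS]addrC addrA subrK.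
apply: (le_trans (ler_enormD _ _)).
by rewrite mulrDr lerD// (enorm_le_metric mab).
Qed.

(** The penalties add up to at most M K^2 times the sum of the squared lengths, hence times the
    square of the total length: cost exceeds length only to second order. *)
Lemma chain_le_quadratic y L S : chain y L S -> L <= S + M * K ^+ 2 * S ^+ 2.
Proof.
elim=> [|z L' S' y' c IH]; first by rewrite expr0n mulr0 addr0.
have /andP[S0 _] := chain_ge0 c.
rewrite /ell; set d := mnorm _ _.
have d0 : 0 <= d by exact: mnorm_ge0.
have : M * enorm (y' - z) ^+ 2 <= M * (K * d) ^+ 2.
  rewrite ler_wpM2l// ler_sqr ?nnegrE ?enorm_ge0 ?mulr_ge0 ?(ltW K0)//.
  exact: enorm_le_metric mab _ _.
have : 0 <= M * K ^+ 2 * (S' * d) by rewrite !mulr_ge0// ltW.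
have -> : (S' + d) ^+ 2 = S' ^+ 2 + 2 * (S' * d) + d ^+ 2 by ring.
rewrite exprMn; lra.
Qed.

Lemma dist_has_inf y : has_inf [set L | exists S, chain y L S].
Proof.
split; first by exists (0 + ell x0 y), (0 + mnorm (b y) (y - x0));
  apply/chain_cons/chain_nil.
by exists 0 => L [S /chain_ge0/andP[S0]]; exact: le_trans.
Qed.

Lemma dist_le y L S : chain y L S -> dist y <= L.
Proof.
by move=> c; apply: inf_lbound; [case: (dist_has_inf y)|exists S].
Qed.

Lemma dist_chain y e : 0 < e -> exists L S, chain y L S /\ L < dist y + e.
Proof.
move=> e0; have [L [S c] Le] := inf_adherent e0 (dist_has_inf y).
by exists L, S.
Qed.

Lemma dist_ge y r : (forall L S, chain y L S -> r <= L) -> r <= dist y.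
Proof.
move=> rL; apply: lb_le_inf; first by case: (dist_has_inf y).
by move=> L [S]; exact: rL.
Qed.

Lemma dist_ge0 y : 0 <= dist y.
Proof.
by apply: dist_ge => L S /chain_ge0/andP[S0]; exact: le_trans.
Qed.

Lemma dist0 : dist x0 = 0.
Proof. by apply/eqP; rewrite eq_le dist_ge0 andbT (dist_le chain_nil). Qed.

Lemma enorm_le_dist y : enorm (y - x0) <= K * dist y.
Proof.
rewrite mulrC -ler_pdivrMr//; apply: dist_ge => L S c.
rewrite ler_pdivrMr// mulrC; apply: (le_trans (chain_enorm c)).
by rewrite ler_wpM2l ?(ltW K0)//; case/andP: (chain_ge0 c).
Qed.

Lemma dist_gt0 y : y != x0 -> 0 < dist y.
Proof.
move=> yx; rewrite -(pmulr_rgt0 _ K0); apply: lt_le_trans (enorm_le_dist y).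
by rewrite enorm_gt0 subr_eq0.
Qed.

Lemma dist_step z y : dist y <= dist z + ell z y.
Proof.
apply/ler_addgt0Pr => e e0; have [L [S [c Le]]] := dist_chain z e0.
apply: (le_trans (dist_le (chain_cons y c))).
by rewrite addrAC lerD2r ltW.
Qed.

Lemma dist_le_ell y : dist y <= ell x0 y.
Proof. by have := dist_step x0 y; rewrite dist0 add0r. Qed.

Lemma dist_continuous : continuous dist.
Proof.
apply/continuous_enormP => x e e0; exists (Num.min 1 (e / (K + M + 1))) => [|y].
  by rewrite lt_min ltr01 divr_gt0// ltr_wpDl// addr_ge0// ltW.
rewrite lt_min => /andP[yx1]; rewrite ltr_pdivlMr; last first.
  by rewrite ltr_wpDl// addr_ge0// ltW.
move=> yxe; apply: le_lt_trans yxe.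
have n0 := enorm_ge0 (y - x).
have sq : M * enorm (y - x) ^+ 2 <= M * enorm (y - x).
  by rewrite ler_wpM2l// expr2 ler_piMr// ltW.
have := dist_step x y; have := dist_step y x.
have := ell_le x y; have := ell_le y x; rewrite (enormBC x y) => ? ? ? ?.
by rewrite ler_norml; apply/andP; split; lra.
Qed.

(* Moving the endpoint by [xi] and the earlier vertices proportionally to the length
   travelled gives the optimal second order term |xi|^2 / (2 S). *)
Lemma chain_superdiff (N : R) y L S : 0 <= N -> chain y L S ->
  exists G, forall xi, enorm xi <= N * S ->
    dist (y + xi) <= L + dot G xi + 2^-1 * bform (b y) xi xi * S^-1
      + (2 * K ^+ 3 + K * N + M) * (1 + S) * enorm xi ^+ 2.
Proof.
move=> N0; set E := 2 * K ^+ 3 + K * N + M.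
have E0 : 0 <= E by rewrite !addr_ge0 ?mulr_ge0 ?exprn_ge0// ltW.
have K2K3 : K ^+ 2 <= K ^+ 3 by rewrite [leRHS]exprS ler_peMl// sqr_ge0.
have K30 : 0 <= K ^+ 3 by rewrite exprn_ge0// ltW.
have KN0 : 0 <= K * N by rewrite mulr_ge0// ltW.
have K20 : 0 <= K ^+ 2 by exact: sqr_ge0.
(* [E1] bounds what a new edge of length d contributes in front of k |xi|^2, [E2] what it
   contributes in front of d |xi|^2. *)
have E1 : 3 / 2 * K ^+ 2 + K * N / 2 + M <= E by rewrite /E; move: M0; lra.
have E2 : K ^+ 3 / 2 <= E by rewrite /E; move: M0; lra.
clearbody E; elim=> [|z {}L {}S {}y c [G GP]].
  (* At length 0 only xi = 0 is admissible, and S^-1 is 0 by convention. *)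
  exists 0 => xi; rewrite mulr0 => xi0.
  have /eqP : enorm xi == 0 by rewrite eq_le xi0 enorm_ge0.
  move/eqP; rewrite enorm_eq0 => /eqP->.
  by rewrite addr0 dist0 dot0r enorm0 invr0 expr0n !mulr0 !addr0.
have /andP[S0 SL] := chain_ge0 c.
have [->|yz] := eqVneq y z.
  by exists G; rewrite /ell subrr mnorm0 enorm0 expr0n mulr0 !addr0.
set D := y - z; set d := mnorm (b y) D.
have D0 : 0 < enorm D by rewrite enorm_gt0 subr_eq0.
have Dd : enorm D <= K * d by exact: enorm_le_metric mab _ _.
have d0 : 0 < d by rewrite -(pmulr_rgt0 _ K0) (lt_le_trans D0).
set T := S + d; have T0 : 0 < T by rewrite ltr_wpDl.
(* The vertex z, at length S out of T, moves by t xi; the last edge D becomes D + k xi. *)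
set k := d / T; set t := S / T.
have kT : k * T = d by rewrite /k; field; rewrite gt_eqF.
have tT : t * T = S by rewrite /t; field; rewrite gt_eqF.
have tk : t + k = 1 by rewrite -mulrDl divff ?gt_eqF.
have t0 : 0 <= t by rewrite divr_ge0// ltW.
have k0 : 0 < k by rewrite divr_gt0.
have t1 : t <= 1 by move: tk k0; lra.
have k1 : k <= 1 by move: tk t0; lra.
have [g gP] := metric_taylor mab y D.
(* In order: the earlier edges, the derivative of the length of the last edge, the derivative of its
   penalty. *)
exists (t *: G + (2 * d)^-1 *: (g + 2 * k *: (D *m b y)) + 2 * M * k *: D) => xi xiN.
have e0 := enorm_ge0 xi.
set X := enorm xi ^+ 2; have X0 : 0 <= X by exact: sqr_ge0.
have first_part : dist (z + t *: xi) <= L + t * dot G xi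
    + 2^-1 * bform (b y) xi xi * (t / T) + k * K ^+ 2 * X / 2
    + E * (1 + S) * (t ^+ 2 * X).
  have txi : enorm (t *: xi) <= N * S.
    by rewrite enormZ ger0_norm// -tT mulrCA ler_wpM2l.
  have := GP _ txi; rewrite dotZr bformZl bformZr enormZ ger0_norm// exprMn.
  move/le_trans; apply; rewrite -/X lerD2r -!addrA !lerD2l.
  have -> : 2^-1 * (t * (t * bform (b z) xi xi)) / S =
      2^-1 * bform (b z) xi xi * (t / T).
    have [S00|Sn0] := eqVneq S 0; first by rewrite /t S00 !mul0r !mulr0 !mul0r.
    by rewrite /t; field; rewrite Sn0 gt_eqF.
  have tT0 : 0 <= t / T by rewrite divr_ge0// ltW.
  have := le_trans (ler_norm _) (metric_lip mab y z xi xi).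
  rewrite (enormBC z y) -/D -[_ * enorm xi * _]mulrA -expr2 -/X => bz.
  have : K * enorm D * X <= K * (K * d) * X.
    by rewrite ler_wpM2r// ler_wpM2l// ltW.
  move=> KD; have : bform (b z) xi xi * (t / T) <=
      (bform (b y) xi xi + K ^+ 2 * d * X) * (t / T).
    rewrite ler_wpM2r//; move: KD bz; rewrite expr2; lra.
  have : K ^+ 2 * d * X * (t / T) <= k * K ^+ 2 * X.
    have -> : K ^+ 2 * d * X * (t / T) = k * K ^+ 2 * X * t.
      by rewrite /k; field; rewrite gt_eqF.
    have : k * K ^+ 2 * X * t <= k * K ^+ 2 * X * 1.
      apply: ler_wpM2l => //; apply: mulr_ge0 => //; apply: mulr_ge0; first exact: ltW.
      exact: sqr_ge0.
    by rewrite mulr1.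
  lra.
have second_part : mnorm (b (y + xi)) (D + k *: xi) <= d + (2 * d)^-1 *
     (dot g xi + 2 * k * dot (D *m b y) xi) + K ^+ 3 * d * X / 2 + k * K ^+ 2 * X
     + 2^-1 * bform (b y) xi xi * (k / T) + k * K * N / 2 * X.
  set Q := mnorm _ _.
  (* Linearises the square root at the old length d of the edge. *)
  have AMGM : Q <= (2 * d)^-1 * (Q ^+ 2 + d ^+ 2).
    rewrite mulrC ler_pdivlMr ?mulr_gt0//.
    by have := sqr_ge0 (Q - d); rewrite sqrrB mulr2n; lra.
  apply: (le_trans AMGM).
  have -> : Q ^+ 2 = bform (b (y + xi)) (D + k *: xi) (D + k *: xi).
    exact: sqr_metric mab _ _.
  have d2 : d ^+ 2 = bform (b y) D D by exact: sqr_metric mab _ _.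
  rewrite (bform_sqrD _ _ _ (metric_psd mab _)).
  have b1 : bform (b (y + xi)) D D <= d ^+ 2 + dot g xi + K ^+ 3 * d ^+ 2 * X.
    apply: (le_trans (gP xi)); rewrite -d2 lerD2l.
    have sqD : enorm D ^+ 2 <= (K * d) ^+ 2.
      by rewrite ler_sqr ?nnegrE ?mulr_ge0 ?(ltW K0) ?(ltW d0) ?enorm_ge0.
    by have := ler_wpM2l (mulr_ge0 (ltW K0) X0) sqD; rewrite /X; lra.
  have b2 : k * bform (b (y + xi)) D xi <= k * (bform (b y) D xi + K ^+ 2 * d * X).
    rewrite ler_wpM2l ?(ltW k0)//.
    have := le_trans (ler_norm _) (metric_lip mab y (y + xi) D xi).
    rewrite (_ : y + xi - y = xi); last by rewrite addrAC subrr add0r.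
    have : K * X * enorm D <= K * X * (K * d) by rewrite ler_wpM2l// mulr_ge0// ltW.
    rewrite /X expr2; lra.
  have b3 : k ^+ 2 * bform (b (y + xi)) xi xi <=
      k ^+ 2 * (bform (b y) xi xi + K * (N * T) * X).
    rewrite ler_wpM2l ?sqr_ge0//.
    have := le_trans (ler_norm _) (metric_lip mab y (y + xi) xi xi).
    rewrite (_ : y + xi - y = xi); last by rewrite addrAC subrr add0r.
    have : K * X * enorm xi <= K * X * (N * T) by rewrite ler_wpM2l// mulr_ge0// ltW.
    rewrite /X expr2; lra.
  apply: (@le_trans _ _ ((2 * d)^-1 * (2 * d ^+ 2 + dot g xi + K ^+ 3 * d ^+ 2 * X
      + 2 * (k * (bform (b y) D xi + K ^+ 2 * d * X))
      + k ^+ 2 * (bform (b y) xi xi + K * (N * T) * X)))).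
    rewrite ler_wpM2l ?invr_ge0 ?mulr_ge0 ?(ltW d0)//.
    by move: b1 b2 b3; lra.
  rewrite le_eqVlt; apply/orP; left; apply/eqP.
  by rewrite -/(bform (b y) D xi) /k; field; rewrite !gt_eqF.
apply: (le_trans (dist_step (z + t *: xi) (y + xi))).
rewrite /ell.
have -> : y + xi - (z + t *: xi) = D + k *: xi.
  have -> : k = 1 - t by move: tk; lra.
  by apply/rowP => i; rewrite /D !mxE; ring.
rewrite -/D -/d sqr_enormD dotZr enormZ exprMn real_normK ?num_real// -/X.
rewrite !dotDl !dotZl !dotDl !dotZl.
(* The second order coefficients t^2 / S and k^2 / d are t / T and k / T; that they add up to 1 / T
   is the gain of the proportional motion. *)
have Tsplit : 2^-1 * bform (b y) xi xi * T^-1 =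
    2^-1 * bform (b y) xi xi * (t / T) + 2^-1 * bform (b y) xi xi * (k / T).
  by rewrite -mulrDr -mulrDl tk mul1r.
rewrite Tsplit.
have c1 : M * (k ^+ 2 * X) <= M * (k * X).
  by rewrite ler_wpM2l// ler_wpM2r// expr2 ler_piMl// ltW.
have kX0 : 0 <= k * X by apply: mulr_ge0 (ltW k0) X0.
(* Reducing xi to t xi frees E k |xi|^2, which pays for the terms bounded by [E1]. *)
have c2 : E * (1 + S) * (t ^+ 2 * X) <= E * (1 + S) * X - E * (k * X).
  have S10 : 0 <= 1 + S by rewrite addr_ge0.
  have : E * (1 + S) * (t ^+ 2 * X) <= E * (1 + S) * (t * X).
    apply: ler_wpM2l; first exact: mulr_ge0.
    by apply: ler_wpM2r => //; rewrite expr2 ler_piMl.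
  have -> : t = 1 - k by move: tk; lra.
  have : 0 <= E * (S * (k * X)) by do 2!apply: mulr_ge0 => //.
  lra.
have c3 := ler_wpM2r kX0 E1.
have c4 := ler_wpM2r (mulr_ge0 (ltW d0) X0) E2.
have -> : E * (1 + (S + d)) * X = E * (1 + S) * X + E * (d * X) by ring.
move: first_part second_part c1 c2 c3 c4; rewrite mulrDr; lra.
Qed.


(** Almost minimal chains have 1 / S <= 1 / d + 2 C2, so [chain_superdiff] applies to them with
    uniform constants; compactness of the gradients lets the excess tend to 0. The bound on G holds
    because [dist_step] forbids a descent faster than at unit rate. *)
Lemma dist_superdiff (D N : R) : 0 < D -> 0 < N -> exists2 E, 0 <= E &
  forall y, y != x0 -> dist y <= D -> exists2 G, mnorm (a y) G <= 1 &
    forall xi, enorm xi <= N * dist y ->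
      dist (y + xi) <=
        dist y + dot G xi + 2^-1 * ((dist y)^-1 + E) * bform (b y) xi xi.
Proof.
(* Almost minimal chains satisfy d <= H S, so the radius N H S covers all |xi| <= N d. *)
move=> D0 N0; pose C2 := M * K ^+ 2; pose H := 1 + 2 * C2 * D.
have C20 : 0 <= C2 by rewrite mulr_ge0// sqr_ge0.
have H0 : 0 < H by rewrite ltr_pwDl// !mulr_ge0// ltW.
have NH0 : 0 <= N * H by rewrite mulr_ge0// ltW.
pose E0 := 2 * K ^+ 3 + K * (N * H) + M.
have E00 : 0 <= E0 by rewrite !addr_ge0 ?mulr_ge0 ?exprn_ge0// ltW.
pose E := 2 * C2 + 2 * (E0 * (1 + 2 * D) * K ^+ 2).
have D20 : 0 <= 1 + 2 * D by rewrite addr_ge0// mulr_ge0// ltW.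
have EE0 : 0 <= E.
  apply: addr_ge0; apply: mulr_ge0 => //.
  exact: mulr_ge0 (mulr_ge0 E00 D20) (sqr_ge0 K).
exists E => // y yx0 dD; have d0 := dist_gt0 yx0; set d := dist y in dD d0 *.
have approx e : 0 < e <= d -> exists G, forall xi, enorm xi <= N * d ->
    dist (y + xi) <= d + e + dot G xi + 2^-1 * (d^-1 + E) * bform (b y) xi xi.
  move=> /andP[e0 ed]; have [L [S [c Le]]] := dist_chain y e0.
  rewrite -/d in Le; have /andP[S0 SL] := chain_ge0 c.
  have dL : d <= L by exact: dist_le c.
  have LS := chain_le_quadratic c; rewrite -/C2 in LS.
  have S2d : S <= 2 * d by lra.
  have SSd : C2 * S ^+ 2 <= C2 * (2 * d * S).
    by rewrite ler_wpM2l// expr2 ler_wpM2r.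
  have SdD : C2 * (2 * d * S) <= C2 * (2 * D * S).
    by rewrite ler_wpM2l// ler_wpM2r// ler_wpM2l.
  have dSH : d <= S * H by rewrite /H; lra.
  have Spos : 0 < S by rewrite -(pmulr_lgt0 _ H0) (lt_le_trans d0).
  have SV : S^-1 <= d^-1 + 2 * C2.
    rewrite -(ler_pM2l (mulr_gt0 Spos d0)).
    have -> : S * d * S^-1 = d by field; rewrite gt_eqF.
    have -> : S * d * (d^-1 + 2 * C2) = S + C2 * (2 * d * S).
      by field; rewrite gt_eqF.
    lra.
  have [G GP] := chain_superdiff NH0 c; exists G => xi xid.
  have := GP xi; rewrite -/E0 => /(_ _)/le_trans; apply.
    by apply: (le_trans xid); rewrite -mulrA [H * S]mulrC ler_wpM2l ?(ltW N0).
  have B0 : 0 <= bform (b y) xi xi by exact: (proj2 (metric_psd mab y)).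
  have xiB : enorm xi ^+ 2 <= K ^+ 2 * bform (b y) xi xi.
    rewrite -(sqr_metric mab) -exprMn ler_sqr ?nnegrE ?enorm_ge0//.
      exact: enorm_le_metric mab _ _.
    by rewrite mulr_ge0 ?mnorm_ge0// ltW.
  have h1 : bform (b y) xi xi * S^-1 <= bform (b y) xi xi * (d^-1 + 2 * C2).
    by rewrite ler_wpM2l.
  have h2 : E0 * (1 + S) * enorm xi ^+ 2 <=
      E0 * (1 + 2 * D) * (K ^+ 2 * bform (b y) xi xi).
    apply: ler_pM xiB; [exact: mulr_ge0 E00 (addr_ge0 ler01 S0)|exact: sqr_ge0|].
    by apply: ler_wpM2l => //; lra.
  by move: h1 h2; rewrite /E; lra.
set c := 2^-1 * (d^-1 + E) in approx *.
have c0 : 0 < c by rewrite mulr_gt0// ltr_pwDl// invr_gt0.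
clearbody c.
have B0 xi : 0 <= bform (b y) xi xi by exact: (proj2 (metric_psd mab y)).
have /choice[G GP] (k : nat) : exists G, forall xi, enorm xi <= N * d ->
    dist (y + xi) <= d + d / k.+1%:R + dot G xi + c * bform (b y) xi xi.
  apply: approx; rewrite divr_gt0//= ler_pdivrMr// ler_peMr ?(ltW d0)//.
  by rewrite ler1n.
set rho := N * d in GP *; have rho0 : 0 < rho by rewrite mulr_gt0.
clearbody rho.
(* Each [G k] is bounded because the distance stays nonnegative after a move of length rho against
   it. *)
have [k|G0 G0P] := @bounded_seq_cluster _ _ G ((2 * d + c * (K * rho ^+ 2)) / rho).
  rewrite ler_pdivlMr//; have [->|Gn0] := eqVneq (G k) 0.
    rewrite enorm0 mul0r; apply: addr_ge0; first exact: mulr_ge0 (ltW d0).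
    exact: mulr_ge0 (ltW c0) (mulr_ge0 (ltW K0) (sqr_ge0 _)).
  have n0 : 0 < enorm (G k) by rewrite enorm_gt0.
  have := GP k (- (rho / enorm (G k)) *: G k).
  have -> : enorm (- (rho / enorm (G k)) *: G k) = rho.
    rewrite enormZ normrN ger0_norm ?divr_ge0 ?enorm_ge0 ?(ltW rho0)//.
    by field; rewrite gt_eqF.
  move=> /(_ (lexx _)) h.
  have := metric_ub mab y (- (rho / enorm (G k)) *: G k).
  have -> : enorm (- (rho / enorm (G k)) *: G k) = rho.
    rewrite enormZ normrN ger0_norm ?divr_ge0 ?enorm_ge0 ?(ltW rho0)//.
    by field; rewrite gt_eqF.
  move=> h2; have := ler_wpM2l (ltW c0) h2.
  move: h; rewrite dotZr -sqr_enorm.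
  have -> : - (rho / enorm (G k)) * enorm (G k) ^+ 2 = - (enorm (G k) * rho).
    by field; rewrite gt_eqF.
  have := dist_ge0 (y + - (rho / enorm (G k)) *: G k).
  have : d / k.+1%:R <= d.
    by rewrite ler_pdivrMr// ler_peMr ?(ltW d0)// ler1n.
  move: (dist _) (bform _ _ _) (d / k.+1%:R) => A1 B1 D1.
  clearbody d; lra.
have GP0 xi : enorm xi <= rho ->
    dist (y + xi) <= d + dot G0 xi + c * bform (b y) xi xi.
  move=> xir; apply/ler_addgt0Pr => e e0.
  have n0 := enorm_ge0 xi.
  have e10 : 0 < e / (1 + enorm xi) by rewrite divr_gt0// ltr_wpDr.
  have [k kN kG] := G0P (e / (1 + enorm xi)) (Num.bound (d / (e / (1 + enorm xi)))) e10.
  have kd : d / k.+1%:R <= e / (1 + enorm xi).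
    rewrite ler_pdivrMr// mulrC -ler_pdivrMr//; apply: ltW.
    apply: (lt_le_trans (archi_boundP _)); first by rewrite divr_ge0 ?ltW.
    by rewrite ler_nat; apply: leqW.
  have := GP k xi xir; have := dot_le (G k - G0) xi; rewrite dotBl => h1 h2.
  have h3 : enorm (G k - G0) * enorm xi <= e / (1 + enorm xi) * enorm xi.
    by rewrite ler_wpM2r// ltW.
  have h4 : e / (1 + enorm xi) + e / (1 + enorm xi) * enorm xi = e.
    by field; rewrite gt_eqF// ltr_wpDr.
  by move: (d / k.+1%:R) (e / _) kd h1 h2 h3 h4 => *; lra.
exists G0 => //; set g := mnorm (a y) G0; rewrite leNgt; apply/negP => g1.
have g0 : 0 < g by exact: lt_trans g1.
(* Going back by t times the dual of [G0] lowers the distance by t g^2, while returning to y costs t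
   g. The second order errors add up to q (t g)^2, so g > 1 fails for small t. *)
set q := c + M * K ^+ 2.
have q0 : 0 < q by rewrite ltr_pwDl// mulr_ge0// sqr_ge0.
pose t := Num.min (rho / (K * g)) ((g - 1) / (2 * (q * g))).
have t0 : 0 < t by rewrite lt_min !divr_gt0 ?mulr_gt0// subr_gt0.
have t1 : t * (K * g) <= rho by rewrite -ler_pdivlMr ?mulr_gt0// ge_min lexx.
have t2 : t * (2 * (q * g)) <= g - 1.
  by rewrite -ler_pdivlMr ?mulr_gt0// ge_min lexx orbT.
set v := t *: (G0 *m a y).
have nv : mnorm (b y) v = t * g by rewrite mnormZ (mnorm_sharp mab) ger0_norm// ltW.
have ev : enorm v <= K * (t * g) by rewrite -nv (enorm_le_metric mab).
have := GP0 (- v); rewrite enormN => /(_ _).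
rewrite bformNl bformNr opprK dotNr dotZr (dot_sharp mab) -/g -(sqr_metric mab) nv.
have vr : enorm v <= rho by apply: le_trans ev _; move: t1; lra.
move=> /(_ vr) h1; have := dist_step (y - v) y; rewrite -/d /ell.
rewrite (_ : y - (y - v) = v); last by rewrite opprB addrC subrK.
rewrite nv => h2.
have h3 : M * enorm v ^+ 2 <= M * (K * (t * g)) ^+ 2.
  by rewrite ler_wpM2l// ler_sqr ?nnegrE ?enorm_ge0 ?mulr_ge0 ?(ltW K0) ?(ltW t0)
    ?(ltW g0).
have h4 : t * g * (g - 1) <= t * g * (t * (q * g)).
  by move: h1 h2 h3; rewrite /q !exprMn; lra.
rewrite ler_pM2l ?mulr_gt0// in h4.
have := mulr_gt0 t0 (mulr_gt0 q0 g0).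
lra.
Qed.

(** An almost minimal chain to y crosses the sphere of radius s around y; x is a crossing point, and
    the remaining part costs at least f times the length of y - x in the metric frozen at y. *)
Lemma dist_descent y e : y != x0 -> 0 < e <= 1 -> exists x,
  [/\ 0 < enorm (y - x), enorm (y - x) <= e &
      dist x + (1 - e) * mnorm (b y) (y - x) <= dist y].
Proof.
move=> yx0 /andP[e0 e1].
have ny : 0 < enorm (y - x0) by rewrite enorm_gt0 subr_eq0.
have K30 : 0 < K ^+ 3 by rewrite exprn_gt0.
pose s := Num.min (Num.min e (enorm (y - x0))) (e / (2 * K ^+ 3)).
have s0 : 0 < s by rewrite !lt_min e0 ny divr_gt0// mulr_gt0.
have se : s <= e by rewrite !ge_min lexx.
have sy : s <= enorm (y - x0) by rewrite !ge_min lexx orbT.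
have sK : s * (2 * K ^+ 3) <= e.
  by rewrite -ler_pdivlMr ?mulr_gt0// !ge_min lexx !orbT.
pose f := 1 - K ^+ 3 * s.
have f0 : 0 <= f by rewrite /f; move: sK e1; lra.
have cmp z v : enorm (z - y) < s -> f * mnorm (b y) v <= mnorm (b z) v.
  move=> zs; have := mnorm_metric_lip mab y z v.
  have : K ^+ 2 * enorm (y - z) * enorm v <= K ^+ 2 * s * (K * mnorm (b y) v).
    apply: ler_pM; [exact: mulr_ge0 (sqr_ge0 K) (enorm_ge0 _)|exact: enorm_ge0| |].
      by apply: ler_wpM2l; rewrite ?sqr_ge0// enormBC ltW.
    exact: enorm_le_metric mab _ _.
  by rewrite /f; lra.
have exit z L S : chain z L S -> enorm (z - y) < s -> exists2 x,
    enorm (x - y) = s & dist x + f * mnorm (b y) (z - x) <= L.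
  elim=> [|{}z {}L {}S z' c IH]; first by rewrite enormBC ltNge sy.
  move=> z's; have [zs|zs] := ltP (enorm (z - y)) s.
    have [x xs xL] := IH zs; exists x => //.
    have := cmp z' (z' - z) z's; have := ell_ge z z'.
    have := ler_mnormD (z - x) (z' - z) (metric_psd mab y).
    rewrite (_ : z - x + (z' - z) = z' - x); last by rewrite [LHS]addrC addrA subrK.
    by move=> /(ler_wpM2l f0); lra.
  (* The last edge enters the ball: it is cut on the sphere, [ell_cut] bounding both pieces by the
     whole. *)
  pose phi (t : R) := enorm (z + t *: (z' - z) - y).
  have [||t] := @IVT R phi 0 1 s ler01.
  - apply: continuous_subspaceT => t.
    apply: (@continuous_comp _ _ _ (fun t : R => z + t *: (z' - z)) (fun x => enorm
      (x - y))).
      apply: (@continuousD _ _ _ (fun=> z) (fun t : R => t *: (z' - z))).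
        exact: cst_continuous.
      exact: scalel_continuous.
    exact: continuous_enormB.
  - rewrite /phi scale0r addr0 scale1r [z + (z' - z)]addrC subrK.
    by rewrite ge_min le_max zs (ltW z's) orbT.
  rewrite in_itv/= => t01 tphi; exists (z + t *: (z' - z)) => //.
  set x := z + t *: (z' - z).
  have z'x : z' - x = (1 - t) *: (z' - z) by apply/rowP => i; rewrite /x !mxE; ring.
  have := ell_cut z z' t01; rewrite -/x -z'x.
  have := dist_step z x; have := dist_le c; have := cmp z' (z' - x) z's.
  by lra.
(* As |y - x| = s, this excess is at most e / 2 times the metric norm of y - x. *)
have he : 0 < e * s / (2 * K) by rewrite divr_gt0 ?mulr_gt0.
have [L [S [c Le]]] := dist_chain y he.
have [|x xs xL] := exit _ _ _ c; first by rewrite subrr enorm0.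
exists x; rewrite enormBC xs; split=> //.
have : s <= K * mnorm (b y) (y - x).
  by rewrite -xs enormBC; exact: enorm_le_metric mab _ _.
rewrite -ler_pdivrMl// => sK'.
have h1 : e * s / (2 * K) <= e / 2 * mnorm (b y) (y - x).
  have -> : e * s / (2 * K) = e / 2 * (K^-1 * s) by field; rewrite gt_eqF.
  by rewrite ler_wpM2l// divr_ge0// ltW.
have h2 : (1 - e / 2) * mnorm (b y) (y - x) <= f * mnorm (b y) (y - x).
  by rewrite ler_wpM2r ?mnorm_ge0// /f; move: sK; lra.
lra.
Qed.
End ChainDistance.

(** * A full cone of supergradients propagates globally *)

Section ConicalMaximum.
Context {R : realType} {n : nat} (a b : 'rV[R]_n -> 'M[R]_n) (K : R).
Context (mab : regular_metric a b K) (w : 'rV[R]_n -> R) (C : R).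
Context (C0 : 0 <= C) (w_continuous : continuous w).
Context (w_eikonal : forall x, exists p, prox w C x p /\ mnorm (a x) p = 1).
Context (x0 : 'rV[R]_n).
Context (w_conical :
  forall xi, w (x0 + xi) <= w x0 - mnorm (b x0) xi + C * enorm xi ^+ 2).
Implicit Types (x y z p q v xi : 'rV[R]_n).

Let K1 : 1 <= K. Proof. by case: mab. Qed.
Let K0 : 0 < K. Proof. exact: lt_le_trans K1. Qed.
(** C absorbs the semiconcavity term of w in [w_lip]; K^2 is what cutting edges requires. *)
Let M := C + K ^+ 2.
Let MK : K ^+ 2 <= M. Proof. by rewrite lerDr. Qed.
Let M0 : 0 <= M. Proof. exact: le_trans (sqr_ge0 K) MK. Qed.

Let d := dist b M x0.
Let e y := w y + d y - w x0.

Let d0 y : 0 <= d y. Proof. exact: (dist_ge0 b MK). Qed.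

Let d_gt0 y : y != x0 -> 0 < d y. Proof. exact: (dist_gt0 mab MK). Qed.

Let w_lip z y : w z <= w y + ell b M z y.
Proof.
have [p [pw pa]] := w_eikonal y.
have := pw (z - y); rewrite [y + _]addrC subrK => /le_trans; apply.
rewrite -addrA lerD2l /ell -(mnormN (b y)) opprB enormBC; apply: lerD.
  by apply: (le_trans (dot_le_metric mab y p (z - y))); rewrite pa mul1r.
by rewrite ler_wpM2r ?sqr_ge0// /M lerDl sqr_ge0.
Qed.

(** [w_lip] is added up along a chain. *)
Let e_ge0 y : 0 <= e y.
Proof.
rewrite /e subr_ge0 -lerBlDl; apply: (dist_ge MK) => L S.
elim=> [|z {}L {}S y' _ IH]; first by rewrite subrr.
by have := w_lip z y'; lra.
Qed.

Let e_continuous : continuous e.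
Proof.
move=> y; apply: (@continuousB _ _ _ (fun y => w y + d y) (fun=> w x0)).
  apply: (@continuousD _ _ _ w d); first exact: w_continuous.
  exact: (dist_continuous mab MK).
exact: cst_continuous.
Qed.

(** The cone above w and the straight step bounding d cancel to first order; freezing b at x0 costs
    K^2 |y - x0|^2. *)
Let e_quadratic y : e y <= (C + K ^+ 2 + M) * enorm (y - x0) ^+ 2.
Proof.
have := w_conical (y - x0); rewrite [x0 + _]addrC subrK => h1.
have := dist_le_ell b MK x0 y; rewrite -/d /ell => h2.
have := mnorm_metric_lip mab y x0 (y - x0).
by rewrite /e -mulrA -expr2; lra.
Qed.


(* Discrete form of the differential inequality
   <De, Dd> = |De|^2 / 2 <= (1 / d + E) e,
   valid because |Dw| = |Dd| = 1 and [e] is nonnegative and semiconcave. *)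
Let e_descent (D : R) : 0 < D -> exists2 E, 0 <= E &
  forall y th, y != x0 -> d y <= D -> 0 < th <= 1 -> exists x N,
    [/\ x != x0, enorm (y - x) <= th, 0 < N <= th, d x + (1 - th) * N <= d y &
        e y <= e x + N * (((d x)^-1 + E) * e x + th)].
Proof.
(* The range 2 K d is chosen to contain the minimiser used for [qk]. *)
move=> D0; have [E1 E10 dP] := dist_superdiff mab MK x0 D0 (mulr_gt0 (ltr0n _ 2) K0).
have K20 : 0 <= K ^+ 2 by exact: sqr_ge0.
have K30 : 0 <= K ^+ 3 by rewrite exprn_ge0// ltW.
have CK0 : 0 <= C * K ^+ 2 by exact: mulr_ge0.
pose E := E1 + 2 * (C * K ^+ 2).
have E0 : 0 <= E by rewrite addr_ge0// mulr_ge0.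
exists E => // y th yx0 dyD /andP[th0 th1].
pose r := enorm (y - x0) / 2.
have r0 : 0 < r by rewrite divr_gt0// enorm_gt0 subr_eq0.
have rE : enorm (y - x0) = 2 * r by rewrite /r; lra.
clearbody r.
pose B := K / r + E; have B0 : 0 <= B by rewrite addr_ge0// divr_ge0// ltW.
(* Errors relative to e1: the loss in [dist_descent] (1), the variation of b (K^3), the second order
   term (B K). The choice of e1 keeps their sum below th^2 / 8. *)
pose c := 1 + K ^+ 3 + B * K.
have c1 : 1 <= c by rewrite /c -addrA lerDl addr_ge0// mulr_ge0// ltW.
have c0 : 0 < c by exact: lt_le_trans c1.
pose e1 := Num.min (Num.min 1 (r / 2)) (th ^+ 2 / (8 * c)).
have th20 : 0 < th ^+ 2 by rewrite exprn_gt0.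
have e10 : 0 < e1 by rewrite !lt_min ltr01 !divr_gt0// mulr_gt0.
have e11 : e1 <= 1 by rewrite !ge_min lexx.
have e1r : e1 <= r / 2 by rewrite !ge_min lexx orbT.
have e1c : e1 * (8 * c) <= th ^+ 2.
  by rewrite -ler_pdivlMr ?mulr_gt0// !ge_min lexx !orbT.
have e1th : e1 * c <= th / 8.
  by have : th ^+ 2 <= th; [rewrite expr2 ler_piMl// ltW|lra].
have e101 : 0 < e1 <= 1 by rewrite e10.
have [x [yx0' yxe dxy]] := dist_descent mab MK yx0 e101.
set h := y - x in yx0' yxe dxy.
have hn0 := enorm_ge0 h.
have xx0r : r <= enorm (x - x0).
  have := ler_enormD h (x - x0).
  rewrite (_ : h + (x - x0) = y - x0); last by rewrite /h addrA subrK.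
  by rewrite rE; lra.
have xx0 : x != x0 by rewrite -subr_eq0 -enorm_gt0 (lt_le_trans r0).
have dx0 := d_gt0 xx0.
have rdK : r <= K * d x by apply: (le_trans xx0r); exact: (enorm_le_dist mab MK).
have dxV : (d x)^-1 <= K / r.
  by rewrite -[(d x)^-1]mul1r ler_pdivrMr// mulrAC ler_pdivlMr// mul1r.
pose N := mnorm (b x) h.
have hN : enorm h <= K * N by exact: enorm_le_metric mab _ _.
have N0 : 0 < N by rewrite -(pmulr_rgt0 _ K0) (lt_le_trans yx0').
have NK : N <= K * e1.
  apply: (le_trans (mnorm_metric_le mab _ _)).
  by rewrite ler_wpM2l// ltW.
have Kc : K <= c.
  have : K <= K ^+ 3.
    by rewrite exprS ler_peMr ?(ltW K0)// exprn_ege1.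
  have : 0 <= B * K by rewrite mulr_ge0// ltW.
  by rewrite /c; lra.
have Kec : K * e1 <= c * e1 by rewrite ler_wpM2r// ltW.
have nbyx : (1 - K ^+ 3 * e1) * N <= mnorm (b y) h.
  have := mnorm_metric_lip mab x y h; rewrite enormBC -/h -/N.
  have : K ^+ 2 * enorm h * enorm h <= K ^+ 2 * e1 * (K * N).
    apply: ler_pM => //; first exact: mulr_ge0.
    by apply: ler_wpM2l.
  by rewrite -/h; lra.
have dN : d x + (1 - (1 + K ^+ 3) * e1) * N <= d y.
  have e1' : 0 <= 1 - e1 by rewrite subr_ge0.
  have := ler_wpM2l e1' nbyx; move: dxy; rewrite -/d => dxy h1.
  have : 0 <= K ^+ 3 * (e1 * e1) * N by rewrite !mulr_ge0// ltW.
  lra.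
have cE1 : (1 + K ^+ 3) * e1 + B * (K * e1) <= th ^+ 2 / 8.
  by move: e1c; rewrite /c; lra.
have BK0 : 0 <= B * (K * e1) by rewrite !mulr_ge0// ltW.
have K3e0 : 0 <= (1 + K ^+ 3) * e1 by rewrite mulr_ge0 ?addr_ge0// ltW.
have dxD : d x <= D.
  apply: le_trans dyD; apply: le_trans dN; rewrite lerDl mulr_ge0 ?(ltW N0)//.
  by have : th ^+ 2 / 8 <= 1; [have := e1th; have : th ^+ 2 <= 1;
    [rewrite expr_le1// ltW|lra]|lra].
have [G Ga GP] := dP x xx0 dxD.
have [p [pw pa]] := w_eikonal x.
pose q := p + G; pose k := (d x)^-1 + E.
have k0 : 0 < k by rewrite ltr_pwDl// invr_gt0.
have kB : k <= B by rewrite lerD2r.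
have eP xi : enorm xi <= 2 * K * d x ->
    e (x + xi) <= e x + dot q xi + 2^-1 * k * mnorm (b x) xi ^+ 2.
  move=> /GP; rewrite -/d -(sqr_metric mab) => h1; have h2 := pw xi.
  have : C * enorm xi ^+ 2 <= C * (K * mnorm (b x) xi) ^+ 2.
    rewrite ler_wpM2l// ler_sqr ?nnegrE ?enorm_ge0//.
      exact: enorm_le_metric mab _ _.
    by rewrite mulr_ge0 ?mnorm_ge0// ltW.
  by rewrite /e /q /k /E dotDl exprMn; lra.
have q2 : mnorm (a x) q <= 2.
  apply: (le_trans (ler_mnormD _ _ (cometric_psd mab x))).
  by rewrite pa; lra.
have qk : mnorm (a x) q ^+ 2 <= 2 * k * e x.
  (* The minimiser of the upper bound [eP]: nonnegativity of e there is the inequality |De|^2 <= 2 k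
     e. *)
  pose xi := - k^-1 *: (q *m a x).
  have nxi : mnorm (b x) xi = k^-1 * mnorm (a x) q.
    by rewrite mnormZ normrN ger0_norm ?invr_ge0 ?(ltW k0)// (mnorm_sharp mab).
  have kd : k^-1 <= d x.
    by rewrite -[leRHS]invrK lef_pV2 ?posrE ?invr_gt0// lerDl.
  have xid : enorm xi <= 2 * K * d x.
    apply: (le_trans (enorm_le_metric mab x xi)); rewrite nxi.
    have : k^-1 * mnorm (a x) q <= d x * 2.
      by apply: ler_pM; rewrite ?mnorm_ge0// invr_ge0 ltW.
    by move=> /(ler_wpM2l (ltW K0)); lra.
  have := eP xi xid; rewrite nxi /xi dotZr (dot_sharp mab).
  have := e_ge0 (x + xi); rewrite /xi => h1 /(le_trans h1).
  have -> : e x + - k^-1 * mnorm (a x) q ^+ 2 +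
      2^-1 * k * (k^-1 * mnorm (a x) q) ^+ 2 =
      e x - (2 * k)^-1 * mnorm (a x) q ^+ 2 by field; rewrite gt_eqF.
  rewrite subr_ge0 mulrC ler_pdivrMr ?mulr_gt0//; lra.
have hd : enorm h <= 2 * K * d x.
  by move: yxe e1r rdK r0; lra.
have xhy : x + h = y by rewrite /h addrC subrK.
have := eP h hd; rewrite xhy -/N => eyx.
have Gh : (1 - th ^+ 2 / 8) * N <= dot G h.
  have := GP h hd; rewrite xhy -/d -(sqr_metric mab) -/N => dyx.
  have : ((d x)^-1 + E1) * (N * N) <= B * (K * e1 * N).
    apply: ler_pM; rewrite ?addr_ge0 ?invr_ge0 ?mulr_ge0 ?(ltW N0) ?(ltW dx0)//.
      by apply: le_trans kB; rewrite lerD2l lerDl mulr_ge0.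
    by rewrite ler_wpM2r// ltW.
  have : 0 <= B * (K * e1) * N by rewrite mulr_ge0// ltW.
  have := ler_wpM2r (ltW N0) cE1.
  by move: dN dyx; rewrite expr2; lra.
pose f := h *m b x.
have nf : mnorm (a x) f = N by exact: mnorm_flat mab _ _.
have psda := cometric_psd mab x.
(* The step nearly follows the gradient of d: |f - N G|^2 = N^2 - 2 N <G, h> + N^2 |G|^2 is at most
   N^2 th^2 / 4. *)
have fNG : mnorm (a x) (f - N *: G) <= th / 2 * N.
  rewrite -ler_sqr ?nnegrE ?mnorm_ge0 ?mulr_ge0 ?(ltW N0) ?(ltW th0)//.
  rewrite (sqr_cometric mab) -scaleNr (bform_sqrD _ _ _ psda).
  rewrite -!(sqr_cometric mab) nf (bformC f G (proj1 psda)) -(dot_metric mab).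
  have : N ^+ 2 * mnorm (a x) G ^+ 2 <= N ^+ 2 * 1.
    by rewrite ler_wpM2l ?sqr_ge0// expr_le1 ?mnorm_ge0.
  have := ler_wpM2l (ltW N0) Gh.
  by rewrite sqrrN !expr2; lra.
have ph : dot p h <= N * bform (a x) p G + th / 2 * N.
  rewrite (dot_metric mab x) -/f -{1}(subrK (N *: G) f) bformDr bformZr addrC lerD2l.
  apply: (le_trans (ler_norm _)); apply: (le_trans (bform_le_mnorm _ _ psda)).
  by rewrite pa mul1r.
have Gh1 : dot G h <= mnorm (a x) G * N by exact: dot_le_metric mab _ _ _.
have qpG : mnorm (a x) q ^+ 2 = 1 + 2 * bform (a x) p G + mnorm (a x) G ^+ 2.
  rewrite (sqr_cometric mab) /q -[G]scale1r (bform_sqrD _ _ _ psda) scale1r.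
  by rewrite -!(sqr_cometric mab) pa expr1n mulr1 mul1r.
(* Since |p| = 1, <p, G> = (|q|^2 - 1 - |G|^2) / 2; adding |G| from <G, h> <= |G| N leaves |q|^2 / 2
   - (1 - |G|)^2 / 2. *)
have qh : dot q h <= N * (2^-1 * mnorm (a x) q ^+ 2 + th / 2).
  rewrite dotDl qpG.
  have := mulr_ge0 (ltW N0) (sqr_ge0 (1 - mnorm (a x) G)).
  by rewrite !expr2; lra.
exists x, N; split=> //.
- by apply: (le_trans yxe); have := ler_wpM2l (ltW e10) c1; lra.
- by rewrite N0/=; lra.
- apply: le_trans dN; rewrite lerD2l ler_wpM2r ?(ltW N0)//.
  by have : th ^+ 2 <= th; [rewrite expr2 ler_piMl// ltW|lra].
apply: (le_trans eyx); rewrite -addrA lerD2l.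
have h1 := ler_wpM2l (ltW N0) qk.
have h2 : k * (N * N) <= B * (K * e1 * N).
  apply: ler_pM; rewrite ?mulr_ge0 ?(ltW N0) ?(ltW k0)//.
  by rewrite ler_wpM2r// ltW.
have th2 : th ^+ 2 <= th by rewrite expr2 ler_piMl// ltW.
have h3 : B * (K * e1 * N) <= th / 8 * N.
  have : B * (K * e1) <= th / 8 by lra.
  by move=> /(ler_wpM2r (ltW N0)); lra.
have thN : 0 <= th * N by rewrite mulr_ge0// ltW.
by move: qh; rewrite expr2 -/k; lra.
Qed.




(* The step inequalities are incompatible with [F x <= F y], where
   F = e^2 exp (- 2 E d) / d^3; the exponent 3 exceeds the 2 / d produced by
   2 (1 / d + E), which is what makes the argument work. *)
Let scalar_contradiction (E D P U dx dy ex N th : R) :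
  0 <= E -> 0 < U -> 0 < dx -> dx <= D -> dx^-1 <= P -> 0 <= ex -> 0 < N <= th ->
    th <= 1 ->
  dx + (1 - th) * N <= dy -> U <= ex + N * ((dx^-1 + E) * ex + th) ->
  ex ^+ 2 * dy ^+ 3 * expR (2 * E * (dy - dx)) <= U ^+ 2 * dx ^+ 3 ->
  th * ((P + E) * U + 1) <= U / 2 ->
  U ^+ 2 <= 4 * D * th * (U ^+ 2 * (2 * E + 3 * P) + 2 * U + ((P + E) * U + 1) ^+ 2).
Proof.
move=> E0 U0 dx0 dxD dxP ex0 /andP[N0 Nth] th1 dxy Uex Fle thU.
have th0 : 0 < th by exact: lt_le_trans Nth.
have nt0 : 0 <= (1 - th) * N by rewrite mulr_ge0 ?subr_ge0// ltW.
have dy0 : 0 < dy by apply: lt_le_trans dxy; rewrite ltr_pwDl.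
have dle : dx <= dy by apply: le_trans dxy; rewrite lerDl.
have [tau tauE] : exists tau, tau = (1 - th) * N by exists ((1 - th) * N).
rewrite -tauE in nt0 dxy.
have P0 : 0 < P by rewrite (lt_le_trans _ dxP)// invr_gt0.
have exp1 : 1 + 2 * E * tau <= expR (2 * E * (dy - dx)).
  apply: le_trans (expR_ge1Dx _); rewrite lerD2l ler_wpM2l ?mulr_ge0//.
  by rewrite lerBrDl.
have dy3 : dx ^+ 3 + 3 * dx ^+ 2 * tau <= dy ^+ 3.
  have : (dx + tau) ^+ 3 <= dy ^+ 3 by rewrite lerXn2r ?nnegrE ?addr_ge0// ltW.
  have : 0 <= 3 * dx * tau ^+ 2 + tau ^+ 3.
    apply: addr_ge0; last exact: exprn_ge0.
    by apply: mulr_ge0 (sqr_ge0 _); rewrite mulr_ge0// ltW.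
  by rewrite (_ : (dx + tau) ^+ 3 = dx ^+ 3 + 3 * dx ^+ 2 * tau +
    (3 * dx * tau ^+ 2 + tau ^+ 3)); [lra|ring].
have [k kE] : exists k, k = dx^-1 by exists dx^-1.
rewrite -kE in dxP Uex.
have k0 : 0 < k by rewrite kE invr_gt0.
have kdx : dx * k = 1 by rewrite kE divff// gt_eqF.
have main : ex ^+ 2 * ((1 + 3 * tau * k) * (1 + 2 * E * tau)) <= U ^+ 2.
  have m1 : (dx ^+ 3 + 3 * dx ^+ 2 * tau) * (1 + 2 * E * tau) <=
      dy ^+ 3 * expR (2 * E * (dy - dx)).
    have dx2 : 0 <= dx ^+ 2 by exact: sqr_ge0.
    have dx3 : 0 <= dx ^+ 3 by rewrite exprn_ge0// ltW.
    apply: ler_pM => //; apply: addr_ge0 => //; apply: mulr_ge0 => //.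
      exact: mulr_ge0.
    exact: mulr_ge0.
  have m2 := ler_wpM2l (sqr_ge0 ex) m1.
  rewrite -(ler_pM2r (exprn_gt0 3 dx0)); apply: le_trans Fle.
  apply: le_trans (le_trans m2 _); last by rewrite mulrA.
  rewrite le_eqVlt; apply/orP; left; apply/eqP.
  have -> : ex ^+ 2 * ((1 + 3 * tau * k) * (1 + 2 * E * tau)) * dx ^+ 3 =
      ex ^+ 2 * ((dx ^+ 3 + 3 * dx ^+ 2 * tau * (dx * k)) * (1 + 2 * E * tau)) by ring.
  by rewrite kdx mulr1.
have exU : ex <= U.
  rewrite -ler_sqr ?nnegrE ?(ltW U0)//; apply: le_trans main.
  rewrite ler_peMr ?sqr_ge0//.
  have h1 : 0 <= 3 * tau * k by rewrite !mulr_ge0// ltW.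
  have h2 : 0 <= 2 * E * tau by rewrite !mulr_ge0.
  by have := mulr_ge0 h1 h2; lra.
have kPE : k + E <= P + E by rewrite lerD2r.
have kE0 : 0 <= k + E by apply: addr_ge0 (ltW k0) _.
have [W WE] : exists W, W = (k + E) * ex + th by exists ((k + E) * ex + th).
rewrite -WE in Uex.
have W0 : 0 <= W by rewrite WE; apply: addr_ge0 (ltW th0); apply: mulr_ge0.
have WP : W <= (P + E) * U + 1 by rewrite WE; apply: lerD => //; apply: ler_pM.
(* At most half of U is gained in the step, so ex stays away from 0. *)
have exU2 : U / 2 <= ex.
  have : N * W <= th * ((P + E) * U + 1) by apply: ler_pM => //; exact: ltW.
  by lra.
have U2 : U ^+ 2 <= ex ^+ 2 + 2 * ex * (N * W) + N ^+ 2 * W ^+ 2.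
  have : U ^+ 2 <= (ex + N * W) ^+ 2.
    by rewrite ler_sqr ?nnegrE ?addr_ge0 ?mulr_ge0// ltW.
  by rewrite sqrrD -mulr_natl exprMn; lra.
have step : ex ^+ 2 * (3 * tau * k + 2 * E * tau) <= N * (2 * ex * W + N * W ^+ 2).
  have : 0 <= ex ^+ 2 * (3 * tau * k * (2 * E * tau)).
    by rewrite !mulr_ge0 ?sqr_ge0// ltW.
  by move: main U2; rewrite expr2; lra.
(* After division by N, the power 3 contributes 3 k and the growth of e only 2 k; the terms 2 E
   cancel and k remains. *)
have {}step : ex ^+ 2 * k <= th * (ex ^+ 2 * (2 * E + 3 * k) + 2 * ex + W ^+ 2).
  have : N * (ex ^+ 2 * ((1 - th) * (3 * k + 2 * E))) <= N * (2 * ex * W + N * W ^+ 2).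
    by apply: le_trans step; rewrite tauE le_eqVlt; apply/orP; left; apply/eqP; ring.
  rewrite ler_pM2l//.
  have : N * W ^+ 2 <= th * W ^+ 2 by rewrite ler_wpM2r ?sqr_ge0.
  have : 2 * ex * W = 2 * ex ^+ 2 * k + 2 * ex ^+ 2 * E + 2 * ex * th.
    by rewrite WE; ring.
  by lra.
have D0 : 0 < D by exact: lt_le_trans dxD.
have l1 : U ^+ 2 <= 4 * ex ^+ 2.
  have : (U / 2) ^+ 2 <= ex ^+ 2 by rewrite ler_sqr ?nnegrE// divr_ge0 ?ltW.
  by lra.
have l2 : ex ^+ 2 <= D * (ex ^+ 2 * k).
  have := ler_wpM2l (mulr_ge0 (sqr_ge0 ex) (ltW k0)) dxD.
  by rewrite (_ : _ * dx = ex ^+ 2 * (dx * k)); [rewrite kdx mulr1; lra|ring].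
have l3 : ex ^+ 2 * (2 * E + 3 * k) + 2 * ex + W ^+ 2 <=
    U ^+ 2 * (2 * E + 3 * P) + 2 * U + ((P + E) * U + 1) ^+ 2.
  apply: lerD; last by rewrite ler_sqr ?nnegrE// (le_trans W0).
  apply: lerD; last by rewrite ler_wpM2l.
  apply: ler_pM; first exact: sqr_ge0.
  - by apply: addr_ge0; apply: mulr_ge0 => //; exact: ltW.
  - by rewrite ler_sqr ?nnegrE// ltW.
  by rewrite lerD2l ler_wpM2l.
apply: (le_trans l1).
have l4 := ler_wpM2l (ltW th0) l3.
have := ler_wpM2l (ltW D0) (le_trans step l4); move: l2.
by rewrite !mulrA; lra.
Qed.

Lemma le_sub_dist y : w y <= w x0 - d y.
Proof.
rewrite leNgt; apply/negP => wy.
have ey : 0 < e y by rewrite /e; lra.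
have yx0 : y != x0.
  by apply/eqP => yx; move: wy; rewrite yx /d (dist0 b MK) subr0 ltxx.
set D := d y; have D0 : 0 < D := d_gt0 yx0.
have [E E0 stepP] := e_descent D0.
pose F z := e z ^+ 2 * expR (- (2 * E * d z)) / d z ^+ 3.
have F0 : 0 < F y.
  by rewrite divr_gt0 ?exprn_gt0// mulr_gt0 ?exprn_gt0// expR_gt0.
pose C3 := C + K ^+ 2 + M.
have C30 : 0 <= C3 by rewrite !addr_ge0 ?sqr_ge0.
pose C4 := C3 ^+ 2 * K ^+ 3 + 1.
have C40 : 0 < C4.
  by apply: ltr_wpDl => //; apply: mulr_ge0 (sqr_ge0 _) _; rewrite exprn_ge0// ltW.
have Fsmall z : z != x0 -> F z <= C4 * enorm (z - x0).
  move=> zx0; have dz0 := d_gt0 zx0; rewrite /F ler_pdivrMr ?exprn_gt0//.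
  have n0 := enorm_ge0 (z - x0).
  have ez2 : e z ^+ 2 <= C3 ^+ 2 * enorm (z - x0) * enorm (z - x0) ^+ 3.
    have -> : C3 ^+ 2 * enorm (z - x0) * enorm (z - x0) ^+ 3 =
      (C3 * enorm (z - x0) ^+ 2) ^+ 2 by ring.
    by rewrite ler_sqr ?nnegrE ?mulr_ge0 ?sqr_ge0// e_quadratic.
  have nK : enorm (z - x0) ^+ 3 <= (K * d z) ^+ 3.
    rewrite lerXn2r ?nnegrE// ?mulr_ge0 ?(ltW K0) ?(ltW dz0)//.
    exact: (enorm_le_dist mab MK).
  have exp1 : expR (- (2 * E * d z)) <= 1.
    by rewrite -expR0 ler_expR oppr_le0 !mulr_ge0// ltW.
  apply: (@le_trans _ _ (e z ^+ 2 * 1)); first by rewrite ler_wpM2l ?sqr_ge0.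
  rewrite mulr1; apply: (le_trans ez2).
  apply: (@le_trans _ _ (C3 ^+ 2 * enorm (z - x0) * (K * d z) ^+ 3)).
    by apply: ler_wpM2l => //; apply: mulr_ge0 (sqr_ge0 _) n0.
  have : 0 <= enorm (z - x0) * d z ^+ 3 by rewrite mulr_ge0// exprn_ge0// ltW.
  by rewrite exprMn /C4; lra.
(* On the punctured ball of radius dl, F is at most F y / 2, so a maximum can be sought away from
   x0. *)
pose dl := F y / (2 * C4); have dl0 : 0 < dl by rewrite divr_gt0// mulr_gt0.
have Fdl z : z != x0 -> enorm (z - x0) <= dl -> F z < F y.
  move=> zx0 zdl; apply: (le_lt_trans (Fsmall z zx0)).
  apply: (@le_lt_trans _ _ (C4 * dl)); first by rewrite ler_wpM2l// ltW.
  have -> : C4 * dl = F y / 2 by rewrite /dl; field; rewrite gt_eqF.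
  by lra.
pose A : set 'rV[R]_n := [set z | enorm (z - x0) <= K * D] `&`
  ([set z | dl <= enorm (z - x0)] `&` [set z | d z <= D]).
have Ay : A y.
  split; first by exact: (enorm_le_dist mab MK).
  split=> //=; rewrite leNgt; apply/negP => /ltW ydl.
  by have := Fdl y yx0 ydl; rewrite ltxx.
have Acompact : compact A.
  apply: compact_closedI; first exact: compact_enorm_ball.
  apply: closedI.
    exact: (closed_comp (fun x _ => @continuous_enormB R n x0 x) (@closed_ge R dl)).
  exact: (closed_comp (fun x _ => @dist_continuous _ _ _ _ _ mab _ MK x0 x)
    (@closed_le R D)).
(* Truncating d makes the quotient continuous across x0; on A nothing changes, since d >= dl / K
   there. *)
pose g z := Num.max (d z) (dl / K).
have dlK0 : 0 < dl / K by rewrite divr_gt0.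
have g0 z : 0 < g z by rewrite lt_max dlK0 orbT.
pose Ft z := e z * e z * expR (- (2 * E * d z)) / (g z * (g z * g z)).
have dc : continuous d by exact: (dist_continuous mab MK).
have gc : continuous g.
  move=> z; apply: (@continuous_max _ _ d (fun=> dl / K)); first exact: dc.
  exact: cst_continuous.
have Ftc : continuous Ft.
  move=> z; apply: (@continuousM _ _ (fun z => e z * e z * expR (- (2 * E * d z)))
      (fun z => (g z * (g z * g z))^-1)).
    apply: (@continuousM _ _ (fun z => e z * e z) (fun z => expR (- (2 * E * d z)))).
      by apply: (@continuousM _ _ e e); exact: e_continuous.
    apply: (@continuous_comp _ _ _ (fun z => - (2 * E * d z)) expR).
      apply: (@continuousN _ _ _ (fun z => 2 * E * d z)).
      by apply: (@continuousM _ _ (fun=> 2 * E) d); [exact: cst_continuous|exact: dc].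
    exact: continuous_expR.
  apply: (@continuousV _ _ (fun z => g z * (g z * g z))).
    by rewrite gt_eqF// !mulr_gt0.
  apply: (@continuousM _ _ g (fun z => g z * g z)); first exact: gc.
  by apply: (@continuousM _ _ g g); exact: gc.
have [||m Am mmax] := @compact_EVT_max _ _ Ft A _ Acompact.
- by exists y.
- exact: continuous_subspaceT.
have FtF z : A z -> Ft z = F z.
  move=> [_ [/= zdl _]]; have gz : g z = d z.
    apply/max_l; rewrite ler_pdivrMr// mulrC; apply: (le_trans zdl).
    exact: (enorm_le_dist mab MK).
  by rewrite /Ft gz /F expr2; congr (_ / _); rewrite !exprS expr0 mulr1.
rewrite inE in Am.
have Fm z : z != x0 -> d z <= D -> F z <= F m.
  have Fym : F y <= F m by rewrite -!FtF//; apply: mmax; rewrite inE.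
  move=> zx0 zD; have [zdl|zdl] := leP (enorm (z - x0)) dl.
    exact: le_trans (ltW (Fdl z zx0 zdl)) Fym.
  have Az : A z.
    split; last by split=> //=; exact: ltW.
    by rewrite /= (le_trans (enorm_le_dist mab MK x0 z))// ler_wpM2l// ltW.
  by rewrite -!FtF//; apply: mmax; rewrite inE.
have mx0 : m != x0.
  apply/eqP => mx; case: Am => _ [/=].
  by rewrite mx subrr enorm0 leNgt dl0.
have [_ [_ /= mD]] := Am.
have em : 0 < e m.
  rewrite lt_neqAle e_ge0 andbT eq_sym; apply/eqP => em0.
  by have := Fm y yx0 (lexx _); rewrite {2}/F em0 expr0n !mul0r leNgt F0.
pose r := enorm (m - x0) / 2; have r0 : 0 < r by rewrite divr_gt0// enorm_gt0 subr_eq0.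
pose P := K / r; have P0 : 0 < P by rewrite divr_gt0.
set U := e m in em.
pose W := U ^+ 2 * (2 * E + 3 * P) + 2 * U + ((P + E) * U + 1) ^+ 2.
have PE0 : 0 <= (P + E) * U by apply: mulr_ge0 (addr_ge0 (ltW P0) E0) (ltW em).
have W0 : 0 < W.
  apply: ltr_pwDr; first by rewrite exprn_gt0// ltr_wpDl.
  apply: addr_ge0; last by rewrite mulr_ge0// ltW.
  apply: mulr_ge0 (sqr_ge0 _) (addr_ge0 (mulr_ge0 _ E0) (mulr_ge0 _ (ltW P0))) => //.
(* th <= r keeps x off x0, whence 1 / d x <= P. The third bound is the smallness asked by
   [scalar_contradiction]; the last one turns its conclusion into U^2 <= U^2 / 2. *)
pose th := Num.min (Num.min 1 r)
  (Num.min (U / 2 / ((P + E) * U + 1)) (U ^+ 2 / (8 * D * W))).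
have DW0 : 0 < 8 * D * W by rewrite !mulr_gt0.
have PU0 : 0 < (P + E) * U + 1 by rewrite ltr_wpDl.
have th0 : 0 < th.
  by rewrite !lt_min ltr01 r0 !divr_gt0// exprn_gt0.
have th1 : th <= 1 by rewrite !ge_min lexx.
have thr : th <= r by rewrite !ge_min lexx orbT.
have thU : th * ((P + E) * U + 1) <= U / 2.
  by rewrite -ler_pdivlMr// !ge_min lexx !orbT.
have thW : th * (8 * D * W) <= U ^+ 2.
  by rewrite -ler_pdivlMr// !ge_min lexx !orbT.
have th01 : 0 < th <= 1 by rewrite th0.
have [x [N [xx0 xm Nth dxm eme]]] := stepP m th mx0 mD th01.
have dx0 := d_gt0 xx0.
have nN0 : 0 <= (1 - th) * N.
  by case/andP: Nth => N0 _; rewrite mulr_ge0 ?subr_ge0// ltW.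
have dxm' : d x <= d m by apply: le_trans dxm; rewrite lerDl.
have dxP : (d x)^-1 <= P.
  have : r <= enorm (x - x0).
    have := ler_enormD (m - x) (x - x0).
    rewrite addrA subrK; have -> : enorm (m - x0) = 2 * r by rewrite /r; lra.
    by lra.
  move=> /le_trans/(_ (enorm_le_dist mab MK x0 x)) rK.
  by rewrite -[(d x)^-1]mul1r ler_pdivrMr// /P mulrAC ler_pdivlMr// mul1r.
have Fxm : e x ^+ 2 * d m ^+ 3 * expR (2 * E * (d m - d x)) <= U ^+ 2 * d x ^+ 3.
  have := Fm x xx0 (le_trans dxm' mD); rewrite /F.
  have dm0 := d_gt0 mx0.
  rewrite ler_pdivrMr ?exprn_gt0// [leRHS]mulrAC ler_pdivlMr ?exprn_gt0//.
  rewrite -(ler_pM2r (expR_gt0 (2 * E * d m))) => h.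
  rewrite mulrBr expRD; apply: le_trans (le_trans _ h) _.
    by rewrite le_eqVlt; apply/orP; left; apply/eqP; ring.
  have eE : expR (- (2 * E * d m)) * expR (2 * E * d m) = 1.
    by rewrite -expRD addNr expR0.
  rewrite le_eqVlt; apply/orP; left; apply/eqP.
  transitivity (U ^+ 2 * d x ^+ 3 *
      (expR (- (2 * E * d m)) * expR (2 * E * d m))); first by rewrite /U; ring.
  by rewrite eE mulr1.
have := scalar_contradiction E0 em dx0 (le_trans dxm' mD) dxP (e_ge0 x) Nth th1 dxm
  eme Fxm thU.
rewrite -/W; have := exprn_gt0 2 em; move: thW.
by rewrite !mulrA; lra.
Qed.

Lemma lt_conical_maximum y : y != x0 -> w y < w x0.
Proof.
by move=> /d_gt0 dy; apply: (le_lt_trans (le_sub_dist y)); rewrite ltrBlDr ltrDl.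
Qed.

End ConicalMaximum.

(** * Supporting directions inside an ellipsoid *)

Section Projection.
Context {R : realType} {n : nat} (M : 'M[R]_n) (K : R).
Context (psdM : psdmx M) (MK : forall v, mnorm M v <= K * enorm v).
Context (M_def : forall v, mnorm M v = 0 -> v = 0).
Implicit Types (p q v : 'rV[R]_n) (D : set 'rV[R]_n).

Lemma mnorm_continuous e : continuous (fun p => mnorm M (p - e)).
Proof.
apply/continuous_enormP => x r r0; exists (r / (`|K| + 1)) => [|y].
  by rewrite divr_gt0// ltr_wpDl.
rewrite ltr_pdivlMr ?ltr_wpDl// => yx; apply: le_lt_trans yx.
apply: (@le_trans _ _ (mnorm M (y - x))).
  have h1 := ler_mnormD (y - x) (x - e) psdM.
  have h2 := ler_mnormD (x - y) (y - e) psdM.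
  rewrite addrA subrK in h1; rewrite addrA subrK in h2.
  rewrite -(opprB y x) mnormN in h2.
  by rewrite ler_norml; apply/andP; split; lra.
apply: (le_trans (MK _)); rewrite mulrC ler_wpM2l ?enorm_ge0//.
by apply: (le_trans (ler_norm _)); rewrite lerDl.
Qed.

Definition convex D : Prop :=
  forall p q t, D p -> D q -> 0 <= t <= 1 -> D (p + t *: (q - p)).

Lemma exists_projection D e : compact D -> convex D -> D !=set0 ->
  exists2 r, D r & (forall p, D p -> mnorm M (r - e) <= mnorm M (p - e)) /\
    forall p, D p -> 0 <= bform M (r - e) (p - r).
Proof.
move=> Dc Dconv D0.
have [|r] := @compact_EVT_min _ _ (fun p => mnorm M (p - e)) D D0 Dc.
  by apply: continuous_subspaceT; exact: mnorm_continuous.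
rewrite inE => Dr rmin; exists r => //.
have {}rmin p : D p -> mnorm M (r - e) <= mnorm M (p - e).
  by move=> Dp; apply: rmin; rewrite inE.
split=> // p Dp; rewrite leNgt; apply/negP => lt0.
set s := bform M (r - e) (p - r) in lt0; set Q := bform M (p - r) (p - r).
have Q0 : 0 <= Q by exact: (proj2 psdM).
(* Moving from r towards p by this t would come closer to e, as 2 s + t Q <= s < 0. *)
pose t := Num.min 1 (- s / (Q + 1)).
have t0 : 0 < t by rewrite lt_min ltr01 divr_gt0 ?oppr_gt0// ltr_wpDl.
have t1 : t <= 1 by rewrite ge_min lexx.
have tQ : t * (Q + 1) <= - s by rewrite -ler_pdivlMr ?ltr_wpDl// ge_min lexx orbT.
have t01 : 0 <= t <= 1 by rewrite (ltW t0).
have := rmin _ (Dconv _ _ _ Dr Dp t01).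
rewrite -ler_sqr ?nnegrE ?mnorm_ge0// !sqr_mnorm//.
rewrite addrAC (bform_sqrD _ _ _ psdM) -/s -/Q -addrA lerDl.
have -> : 2 * t * s + t ^+ 2 * Q = t * (2 * s + t * Q) by ring.
by rewrite pmulr_rge0// => ?; lra.
Qed.

(** In these coordinates the centre of the ball is - c. If it is outside D, its projection has norm
    below 1 by strict convexity, through the midpoint of p1 and p2. If it is in D, project e: were
    the projection r on the sphere, testing with - c would give 1 <= <c + r, c + e>, hence r = e,
    which is not in D. *)
Lemma exists_interior_normal D c p1 p2 e : compact D -> convex D ->
  (forall p, D p -> mnorm M (c + p) <= 1) -> D p1 -> D p2 -> p1 != p2 ->
  mnorm M (c + e) <= 1 -> ~ D e ->
  exists r q, [/\ D r, mnorm M (c + r) < 1, q != 0 &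
                  forall p, D p -> 0 <= dot q (p - r)].
Proof.
move=> Dc Dconv DE D1 D2 p12 e1 De; have D0 : D !=set0 by exists p1.
have done_ r e' : D r -> ~ D e' -> mnorm M (c + r) < 1 ->
    (forall p, D p -> 0 <= bform M (r - e') (p - r)) ->
    exists r q, [/\ D r, mnorm M (c + r) < 1, q != 0 &
                  forall p, D p -> 0 <= dot q (p - r)].
  move=> Dr De' r1 rP; exists r, ((r - e') *m M); split=> //.
  apply/eqP => q0; apply: De'; have /M_def : mnorm M (r - e') = 0.
    by rewrite /mnorm /bform q0 dot0l sqrtr0.
  by move/eqP; rewrite subr_eq0 => /eqP <-.
have [Dc0|Dc0] := pselect (D (- c)).
  have [r Dr [_ rP]] := exists_projection e Dc Dconv D0.
  apply: (done_ r e) => //.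
  rewrite lt_neqAle DE// andbT; apply/eqP => r1.
  have := rP _ Dc0; have -> : - c - r = - (c + r) by rewrite opprD.
  have -> : r - e = (c + r) - (c + e) by rewrite opprD addrACA subrr add0r.
  rewrite bformNr bformDl bformNl -sqr_mnorm// r1 expr1n => h.
  have /M_def re : mnorm M ((c + e) - (c + r)) = 0.
    apply/eqP; rewrite -sqrf_eq0 eq_le sqr_ge0 andbT sqr_mnorm// -scaleN1r.
    rewrite (bform_sqrD _ _ _ psdM) -!sqr_mnorm// r1.
    have : mnorm M (c + e) ^+ 2 <= 1 by rewrite expr_le1 ?mnorm_ge0.
    by rewrite sqrrN !expr1n; lra.
  by apply: De; move: re; rewrite opprD addrACA subrr add0r => /eqP;
    rewrite subr_eq0 => /eqP->.
have [r Dr [rmin rP]] := exists_projection (- c) Dc Dconv D0.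
apply: (done_ r (- c)) => //.
have h01 : 0 <= (2^-1 : R) <= 1 by lra.
have := rmin _ (Dconv _ _ _ D1 D2 h01); rewrite !opprK addrC => /le_lt_trans; apply.
rewrite -[p1 + _ + c]addrAC [p1 + c]addrC.
rewrite -(@ltr_pXn2r _ 2) ?nnegrE ?mnorm_ge0// expr1n sqr_mnorm//.
rewrite (bform_sqrD _ _ _ psdM) -!sqr_mnorm//.
have n1 : mnorm M (c + p1) ^+ 2 <= 1 by rewrite expr_le1 ?mnorm_ge0// DE.
have n2 : mnorm M (c + p2) ^+ 2 <= 1 by rewrite expr_le1 ?mnorm_ge0// DE.
have n3 : 0 < mnorm M (p2 - p1) ^+ 2.
  rewrite exprn_gt0// lt_neqAle mnorm_ge0 andbT eq_sym; apply/eqP => /M_def/eqP.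
  by rewrite subr_eq0 eq_sym (negbTE p12).
have : mnorm M (c + p2) ^+ 2 = mnorm M (c + p1) ^+ 2 +
    2 * bform M (c + p1) (p2 - p1) + mnorm M (p2 - p1) ^+ 2.
  rewrite (_ : c + p2 = (c + p1) + 1 *: (p2 - p1)); last first.
    by rewrite scale1r addrACA subrr addr0.
  by rewrite sqr_mnorm// (bform_sqrD _ _ _ psdM) -!sqr_mnorm// !expr1n; ring.
by move: n1 n2 n3; lra.
Qed.

End Projection.

(** * Propagation along a supporting direction *)

Section SingularArc.
Context {R : realType} {n : nat} (u : 'rV[R]_n -> R) (B0 C B : R).
Context (u_continuous : continuous u) (u_bounded : forall x, `|u x| <= B0).
Context (C0 : 0 < C) (uC : midsc u C).
Context (prox_bounded : forall x p, prox u C x p -> enorm p <= B).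
Implicit Types (x y p q r xi : 'rV[R]_n).

Lemma harmonic_small (e : R) : 0 < e -> exists N, forall k, (N <= k)%N ->
  k.+1%:R^-1 <= e.
Proof.
move=> e0; exists (Num.bound e^-1) => k Nk.
rewrite -[leRHS]invrK lef_pV2 ?posrE ?invr_gt0//; apply: ltW.
apply: lt_le_trans (archi_boundP _) _; first by rewrite invr_ge0 ltW.
by rewrite ler_nat; exact: leqW.
Qed.

Lemma prox_closed_subseq (xs ps : nat -> 'rV[R]_n) x :
  (forall k, prox u C (xs k) (ps k)) ->
  (forall k, enorm (xs k - x) <= k.+1%:R^-1) ->
  exists2 p, prox u C x p &
    forall e, 0 < e -> exists k,
      [/\ k.+1%:R^-1 <= e, enorm (xs k - x) <= e & enorm (ps k - p) <= e].
Proof.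
move=> up xsx; have [|p pP] := @bounded_seq_cluster _ _ ps B.
  by move=> k; exact: prox_bounded (up k).
have near e : 0 < e -> exists k,
    [/\ k.+1%:R^-1 <= e, enorm (xs k - x) <= e & enorm (ps k - p) <= e].
  move=> e0; have [N NP] := harmonic_small e0; have [k Nk kp] := pP e N e0.
  by exists k; split; [exact: NP|exact: le_trans (xsx k) (NP k Nk)|exact: ltW].
exists p => //; apply: (prox_closed u_continuous (ltW C0) up) => e e0.
by have [k [_ ? ?]] := near e e0; exists k.
Qed.

Lemma prox_monotone x y p q : prox u C x p -> prox u C y q ->
  dot (p - q) (x - y) <= 2 * C * enorm (x - y) ^+ 2.
Proof.
move=> up uq; have := up (y - x); have := uq (x - y).
rewrite [y + (x - y)]addrC subrK [x + (y - x)]addrC subrK (enormBC y x).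
rewrite -(opprB x y) dotBl !dotNr; lra.
Qed.

(* Maximising [u - <r, .>] minus the penalty [|. - x0 - s q|^2 / (2 s)]. *)
Lemma exists_penalized_prox x0 r q s : 0 < s ->
  exists x, prox u C x (r + s^-1 *: (x - x0) - q).
Proof.
(* Completing the square merges the linear term r and the shift s q into one centre. *)
move=> s0; pose y := x0 + s *: (q - r).
have Nu : continuous (fun x => - u x).
  by move=> x; apply: (@continuousN _ _ _ u); exact: u_continuous.
have s20 : 0 < (2 * s)^-1 by rewrite invr_gt0 mulr_gt0.
have Nb x : `|- u x| <= B0 by rewrite normrN.
have [x xP] := penalized_min y Nu Nb s20.
exists x; apply: (prox_of_quadratic uC (M := (2 * s)^-1)) => xi.
have := xP (x + xi); rewrite addrAC (sqr_enormD (x - y)).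
have -> : r + s^-1 *: (x - x0) - q = s^-1 *: (x - y).
  apply/rowP => i; rewrite /y !mxE; field; exact: lt0r_neq0.
rewrite dotZl => h; rewrite (_ : s^-1 = 2 * (2 * s)^-1); first by lra.
by field; exact: lt0r_neq0.
Qed.

(** As x s - x0 = s (q + (P s - r)), the derivative at 0 reduces to P s -> r. Monotonicity between x
    s and x0 gives |P s - r|^2 + <q, P s - r> <= O(s). Limits p of P s are supergradients at x0,
    where <q, p - r> >= 0, so |P s - r| tends to 0. *)
Lemma exists_arc x0 r q : prox u C x0 r -> (forall p, prox u C x0 p -> 0 <= dot q
  (p - r)) ->
  exists (tau : R) (x : R -> 'rV[R]_n) (P : R -> 'rV[R]_n),
    [/\ 0 < tau, exists L : R, L.-lipschitz_(`[0, tau[) x, x 0 = x0,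
        h^-1 *: (x h - x 0) @[h --> 0^'+] --> q &
        (forall t, 0 < t -> prox u C (x t) (P t)) /\
        forall e, 0 < e -> exists2 d, 0 < d & forall t, 0 < t < d ->
          enorm (x t - x0) < e /\ enorm (P t - r) < e].
Proof.
move=> ur qr.
(* Setting the arc to x0 for s <= 0 fixes its value at 0. *)
have /choice[x xP] (s : R) : exists x, (0 < s ->
    prox u C x (r + s^-1 *: (x - x0) - q)) /\ (s <= 0 -> x = x0).
  have [s0|s0] := ltP 0 s; last by exists x0; split=> // /lt_geF; rewrite s0.
  by have [x ?] := exists_penalized_prox x0 r q s0; exists x; split.
pose P s := r + s^-1 *: (x s - x0) - q.
have Pprox t : 0 < t -> prox u C (x t) (P t) by move=> t0; apply: (proj1 (xP t)).
have x00 : x 0 = x0 by exact: (proj2 (xP 0)).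
have xE s : 0 < s -> x s - x0 = s *: (q + (P s - r)).
  move=> s0; rewrite /P; apply/rowP => i; rewrite !mxE; field; exact: lt0r_neq0.
pose B' := enorm q + (B + enorm r) + 1.
have B'0 : 0 < B'.
  rewrite ltr_wpDl// !addr_ge0 ?enorm_ge0//.
  exact: le_trans (enorm_ge0 _) (prox_bounded ur).
have vB s : 0 < s -> enorm (q + (P s - r)) <= B'.
  move=> s0; apply: (le_trans (ler_enormD _ _)).
  have := ler_enormD (P s) (- r); rewrite enormN; have := prox_bounded (Pprox s s0).
  by rewrite /B'; lra.
clearbody B'.
have xB s : 0 < s -> enorm (x s - x0) <= s * B'.
  by move=> s0; rewrite xE// enormZ gtr0_norm// ler_wpM2l ?vB// ltW.
have Pcvg e : 0 < e -> exists2 d, 0 < d & forall t, 0 < t < d -> enorm (P t - r) < e.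
  move=> e0; apply: contrapT => nP.
  have /choice[s sP] (k : nat) : exists s, [/\ 0 < s, s * (B' + 1) <= k.+1%:R^-1 &
      e <= enorm (P s - r)].
    apply: contrapT => ns; apply: nP.
    exists (k.+1%:R^-1 / (B' + 1)) => [|t /andP[t0]].
      by rewrite divr_gt0 ?invr_gt0// addr_gt0.
    rewrite ltr_pdivlMr ?addr_gt0// => tk; rewrite ltNge; apply/negP => et.
    by apply: ns; exists t; rewrite ltW.
  have [|k|p up near] := @prox_closed_subseq (x \o s) (P \o s) x0.
  - by move=> k; apply: Pprox; have [] := sP k.
  - have [s0 sk _] := sP k; apply: (le_trans (xB _ s0)); apply: le_trans sk.
    by rewrite ler_wpM2l ?(ltW s0)// lerDl.
  have qp := qr p up.
  (* The two error terms are at most N dl = e^2 / 2, against |P - r|^2 >= e^2. *)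
  pose N := enorm q + 2 * C * B' ^+ 2 + 1.
  have N0 : 0 < N.
    apply: ltr_wpDl => //; apply: addr_ge0 (enorm_ge0 _) _.
    by apply: mulr_ge0 (sqr_ge0 _); rewrite mulr_ge0// ltW.
  have [k [kd _ kp]] := near (e ^+ 2 / (2 * N)) (divr_gt0 (exprn_gt0 2 e0)
    (mulr_gt0 (ltr0n _ 2) N0)).
  have [s0 sk es] := sP k; rewrite /= in kp.
  have eN : e ^+ 2 / (2 * N) * N = e ^+ 2 / 2 by field; exact: lt0r_neq0.
  set dl := e ^+ 2 / (2 * N) in kd kp eN.
  have sdl : s k <= dl.
    apply: le_trans kd; apply: le_trans sk.
    by rewrite -{1}[s k]mulr1 ler_wpM2l ?(ltW s0)// lerDr ltW.
  have := prox_monotone (Pprox _ s0) ur; rewrite xE// dotZr enormZ exprMn.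
  rewrite real_normK ?num_real// mulrCA expr2 -[leRHS]mulrA ler_pM2l// dotDr
    -sqr_enorm => h.
  have hv : C * enorm (q + (P (s k) - r)) ^+ 2 <= C * B' ^+ 2.
    by rewrite ler_wpM2l ?(ltW C0)// ler_sqr ?nnegrE ?enorm_ge0 ?vB// ltW.
  have hv2 := ler_wpM2l (ltW s0) hv.
  have hv3 : s k * (C * B' ^+ 2) <= dl * (C * B' ^+ 2).
    by apply: ler_wpM2r => //; exact: mulr_ge0 (ltW C0) (sqr_ge0 _).
  have he : e ^+ 2 <= enorm (P (s k) - r) ^+ 2.
    by rewrite ler_sqr ?nnegrE ?enorm_ge0// ltW.
  have hq := dot_le (- q) (P (s k) - p); rewrite enormN dotNl in hq.
  have hq2 : enorm q * enorm (P (s k) - p) <= enorm q * dl by rewrite ler_wpM2l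
    ?enorm_ge0.
  have hq3 : dot (P (s k) - r) q = dot q (P (s k) - p) + dot q (p - r).
    by rewrite -dotDr addrA subrK dotC.
  have dl0 : 0 < dl by rewrite -(pmulr_lgt0 _ N0) eN divr_gt0// exprn_gt0.
  have e20 := exprn_gt0 2 e0.
  by move: eN h; rewrite /N hq3; lra.
(* Below tau the semiconcavity term 2 C s |x t - x s|^2 is at most half of the left side of [h4],
   whence the Lipschitz constant 2 B'. *)
pose tau := (4 * C)^-1.
have tau0 : 0 < tau by rewrite invr_gt0 mulr_gt0.
exists tau, x, P; split=> //.
- exists (2 * B') => -[s t] /= []; rewrite !in_itv/=.
  wlog st : s t / s <= t.
    move=> H hs ht; have [/H|/ltW/H] := leP s t; first exact.
    by rewrite distrC (distrC s); exact.
  move=> /andP[s0 stau] /andP[t0 ttau].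
  rewrite [`|s - t|]distrC ger0_norm ?subr_ge0// distrC.
  apply: (le_trans (normr_le_enorm _)).
  have [->|sn0] := eqVneq s 0.
    rewrite x00 subr0; have [->|tn0] := eqVneq t 0.
      by rewrite x00 subrr enorm0 mulr0.
    have tpos : 0 < t by rewrite lt_neqAle eq_sym tn0.
    by apply: (le_trans (xB t tpos)); have := mulr_ge0 t0 (ltW B'0); lra.
  have spos : 0 < s by rewrite lt_neqAle eq_sym sn0.
  have tpos : 0 < t by exact: lt_le_trans st.
  set D := x t - x s; have D0 := enorm_ge0 D.
  have [De0|De0] := eqVneq (enorm D) 0.
    by rewrite De0 mulr_ge0 ?subr_ge0// mulr_ge0// ltW.
  have Dpos : 0 < enorm D by rewrite lt_neqAle eq_sym De0.
  have PD : P t - P s = s^-1 *: D - ((t - s) / s) *: (q + (P t - r)).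
    have -> : q + (P t - r) = t^-1 *: (x t - x0).
      by rewrite (xE t tpos) scalerA mulVf ?scale1r// gt_eqF.
    rewrite /P /D; apply/rowP => i; rewrite !mxE; field.
    by rewrite !gt_eqF.
  have := prox_monotone (Pprox t tpos) (Pprox s spos).
  rewrite -/D PD dotBl !dotZl -sqr_enorm => mono.
  have h1 := dot_le (q + (P t - r)) D.
  have h2 : enorm (q + (P t - r)) * enorm D <= B' * enorm D.
    by rewrite ler_wpM2r ?vB.
  have h3 : (t - s) * dot (q + (P t - r)) D <= (t - s) * (B' * enorm D).
    by rewrite ler_wpM2l ?subr_ge0//; lra.
  have h4 : enorm D ^+ 2 <= (t - s) * dot (q + (P t - r)) D + s * (2 * C) * enorm D
    ^+ 2.
    have := ler_wpM2l (ltW spos) mono.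
    rewrite mulrBr !mulrA divff ?gt_eqF// mul1r [s * (t - s)]mulrC -[_ * s / s]mulrA.
    by rewrite divff ?gt_eqF// mulr1; lra.
  have h5 : s * (2 * C) <= 2^-1.
    have : s * (4 * C) <= tau * (4 * C) by rewrite ler_wpM2r ?mulr_ge0 ?(ltW C0)// ltW.
    by rewrite /tau mulVf ?gt_eqF ?mulr_gt0//; lra.
  have h6 := ler_wpM2r (sqr_ge0 (enorm D)) h5.
  rewrite -(ler_pM2r Dpos); move: h4 h6; rewrite expr2; lra.
- apply/cvgrPdist_lt => e e0; have [dl dl0 dP] := Pcvg e e0.
  near=> h; have h0 : 0 < h by near: h; exact: nbhs_right_gt.
  rewrite x00 (xE h h0) scalerA mulVf ?gt_eqF// scale1r opprD addNKr normrN.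
  apply: (le_lt_trans (normr_le_enorm _)); apply: dP; rewrite h0/=.
  by near: h; exact: nbhs_right_lt.
split=> // e e0; have [dl dl0 dP] := Pcvg e e0.
exists (Num.min dl (e / B')) => [|t]; first by rewrite lt_min dl0 divr_gt0.
rewrite lt_min => /and3P[t0 tdl te]; split; last by apply: dP; rewrite t0.
by apply: (le_lt_trans (xB t t0)); rewrite -ltr_pdivlMr.
Unshelve. all: by end_near.
Qed.

End SingularArc.

(** * Global eikonal solutions *)

Section Eikonal.
Context {R : realType} {n : nat} (a b : 'rV[R]_n -> 'M[R]_n) (K : R).
Context (mab : regular_metric a b K).
Implicit Types (x y p q c : 'rV[R]_n).

Let K1 : 1 <= K. Proof. by case: mab. Qed.
Let K0 : 0 < K. Proof. exact: lt_le_trans K1. Qed.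

Lemma mnorm_cometric_near x y p q (e : R) : enorm q <= K ->
  enorm (y - x) <= e -> enorm (q - p) <= e ->
  mnorm (a y) q ^+ 2 <= (mnorm (a x) p + K * e) ^+ 2 + K ^+ 3 * e.
Proof.
move=> qK yx qp.
have e0 : 0 <= e by exact: le_trans (enorm_ge0 _) yx.
have h1 : mnorm (a x) q <= mnorm (a x) p + K * e.
  rewrite -{1}(subrK p q) addrC.
  apply: (le_trans (ler_mnormD _ _ (cometric_psd mab x))); rewrite lerD2l.
  apply: (le_trans (mnorm_cometric_le mab x _)).
  by rewrite ler_wpM2l// ltW.
have h2 : mnorm (a x) q ^+ 2 <= (mnorm (a x) p + K * e) ^+ 2.
  by rewrite ler_sqr ?nnegrE ?addr_ge0 ?mulr_ge0 ?mnorm_ge0// ltW.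
have := le_trans (ler_norm _) (cometric_lip mab x y q).
rewrite -!(sqr_cometric mab).
have : K * enorm (y - x) * enorm q ^+ 2 <= K * e * K ^+ 2.
  apply: ler_pM; rewrite ?sqr_ge0 ?mulr_ge0 ?enorm_ge0 ?(ltW K0)//.
    by rewrite ler_wpM2l// ltW.
  by rewrite ler_sqr ?nnegrE ?enorm_ge0// ltW.
by move=> h3 h4; move: h2 h3 h4; rewrite (_ : K ^+ 3 * e = K * e * K ^+ 2); [lra|ring].
Qed.

(** Openness of the unit ball: the right side of [mnorm_cometric_near] stays below 1 for some e. *)
Lemma near_lt1 (g : R) : 0 <= g < 1 -> exists2 e, 0 < e &
  (g + K * e) ^+ 2 + K ^+ 3 * e < 1.
Proof.
move=> /andP[g0 g1]; pose L := 2 * K + K ^+ 2 + K ^+ 3 + 1.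
have L0 : 0 < L.
  by apply: ltr_wpDl => //; do 2?apply: addr_ge0;
    rewrite ?sqr_ge0 ?exprn_ge0 ?mulr_ge0// ltW.
have gap : 0 < 1 - g ^+ 2 by rewrite subr_gt0 expr_lt1.
exists (Num.min 1 ((1 - g ^+ 2) / (2 * L))).
  by rewrite lt_min ltr01 divr_gt0// mulr_gt0.
set e := Num.min _ _.
have e0 : 0 < e by rewrite lt_min ltr01 divr_gt0// mulr_gt0.
have e1 : e <= 1 by rewrite ge_min lexx.
have eL : e * (2 * L) <= 1 - g ^+ 2.
  by rewrite -ler_pdivlMr ?mulr_gt0// ge_min lexx orbT.
have h1 : K * e * g <= K * e * 1 by rewrite ler_wpM2l ?mulr_ge0 ?(ltW K0) ?(ltW
  e0)// ltW.
have h2 : K ^+ 2 * (e * e) <= K ^+ 2 * (1 * e) by rewrite ler_wpM2l ?sqr_ge0//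
  ler_wpM2r// ltW.
by clearbody e; move: eL; rewrite /L; lra.
Qed.

Context (u : 'rV[R]_n -> R) (C B0 : R) (c : 'rV[R]_n).
Context (u_continuous : continuous u) (u_bounded : forall x, `|u x| <= B0).
Context (C0 : 0 < C) (uC : midsc u C).
Context (u_sub : forall x p, prox u C x p -> mnorm (a x) (c + p) <= 1).
Context (u_super : forall x p M,
  (forall xi, u x + dot p xi - M * enorm xi ^+ 2 <= u (x + xi)) ->
  1 <= mnorm (a x) (c + p)).

Lemma prox_enorm_shift x p : prox u C x p -> enorm (c + p) <= K.
Proof.
move=> /u_sub up; apply: (le_trans (enorm_le_cometric mab x _)).
by rewrite -[leRHS]mulr1 ler_wpM2l// ltW.
Qed.

Lemma prox_enorm x p : prox u C x p -> enorm p <= K + enorm c.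
Proof.
move=> /prox_enorm_shift up; have := ler_enorm_sub p (- c).
by rewrite opprK enormN [p + c]addrC; lra.
Qed.

(** Where a paraboloid touches u from below, both viscosity inequalities hold for the same p, so its
    norm is 1. Such points are dense, and a limit of their supergradients serves at y. *)
Lemma exists_eikonal_prox y :
  exists2 p, prox u C y p & mnorm (a y) (c + p) = 1.
Proof.
have /choice[s sP] (k : nat) : exists xp : 'rV[R]_n * 'rV[R]_n,
    [/\ enorm (xp.1 - y) <= k.+1%:R^-1, prox u C xp.1 xp.2 &
        1 <= mnorm (a xp.1) (c + xp.2)].
  have k0 : 0 < k.+1%:R^-1 :> R by rewrite invr_gt0.
  have [x [p [M [xy xp]]]] := touching_below_dense y u_continuous u_bounded k0.
  exists (x, p); split=> //=; first exact: prox_of_touching_below uC xp.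
  exact: u_super xp.
have [k|k|p up near] := @prox_closed_subseq _ _ u C _ u_continuous C0 prox_enorm
    (fun k => (s k).1) (fun k => (s k).2) y.
- by have [] := sP k.
- by have [] := sP k.
exists p => //; apply/eqP; rewrite eq_le u_sub//= leNgt; apply/negP => p1.
have [|e e0 eP] := near_lt1 (g := mnorm (a y) (c + p)); first by rewrite mnorm_ge0.
have [k [_ xy pk]] := near e e0; have [_ upk pk1] := sP k.
have := @mnorm_cometric_near y (s k).1 (c + p) (c + (s k).2) e (prox_enorm_shift
  upk) xy.
rewrite opprD addrACA subrr add0r => /(_ pk) h.
have : 1 <= mnorm (a (s k).1) (c + (s k).2) ^+ 2 by rewrite exprn_ege1.
by lra.
Qed.

Lemma prox_shift x p : prox u C x p <-> prox (fun x => u x + dot c x) C x (c + p).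
Proof.
by split=> up xi; have := up xi; rewrite dotDr dotDl; lra.
Qed.

Context (u_periodic : Zperiodic u).

Lemma not_full_superdiff x0 (i : 'I_n) :
  ~ (forall p, mnorm (a x0) (c + p) <= 1 -> prox u C x0 p).
Proof.
move=> full; pose w x := u x + dot c x.
have cw : continuous w.
  move=> x; apply: (@continuousD _ _ _ u (dot c)); first exact: u_continuous.
  exact: continuous_dotl.
have weik x : exists p, prox w C x p /\ mnorm (a x) p = 1.
  have [p up p1] := exists_eikonal_prox x; exists (c + p); split=> //.
  exact/prox_shift.
have wcone xi : w (x0 + xi) <= w x0 - mnorm (b x0) xi + C * enorm xi ^+ 2.
  have [->|xi0] := eqVneq xi 0.
    by rewrite addr0 mnorm0 enorm0 expr0n mulr0 subr0 addr0.
  have nb0 : 0 < mnorm (b x0) xi.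
    rewrite -(pmulr_rgt0 _ K0); apply: lt_le_trans (enorm_le_metric mab x0 xi).
    by rewrite enorm_gt0.
  (* The unit covector with the least pairing with xi. *)
  pose P := - (mnorm (b x0) xi)^-1 *: (xi *m b x0).
  have P1 : mnorm (a x0) P = 1.
    rewrite mnormZ normrN ger0_norm ?invr_ge0 ?mnorm_ge0// (mnorm_flat mab).
    by rewrite mulVf// gt_eqF.
  have /full/prox_shift : mnorm (a x0) (c + (P - c)) <= 1.
    by rewrite addrC subrK P1.
  rewrite addrC subrK => /(_ xi).
  have -> : dot P xi = - mnorm (b x0) xi.
    rewrite dotZl -/(bform (b x0) xi xi) -(sqr_metric mab).
    by field; exact: lt0r_neq0.
  by [].
have wlt := lt_conical_maximum mab (ltW C0) cw weik wcone.
(* The index i supplies a nonzero lattice vector. Under translation only the part <c, .> of w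
   changes, and t = 1, t = -1 give contradictory signs of [c 0 i]. *)
have shift (t : int) : t != 0 -> t%:~R * c 0 i < 0.
  move=> t0; have := wlt (x0 + map_mx intr (t *: delta_mx 0 i)).
  rewrite /w u_periodic dotDr map_mxZ map_delta_mx dotZr.
  have -> : dot c (delta_mx 0 i) = c 0 i.
    rewrite /dot (bigD1 i)//= big1 => [|j ji]; last first.
      by rewrite mxE (negbTE ji) andbF mulr0.
    by rewrite mxE !eqxx mulr1 addr0.
  rewrite addrA gtrDl; apply.
  rewrite -subr_eq0 addrAC subrr add0r; apply/eqP => /rowP/(_ i).
  by rewrite !mxE !eqxx mulr1 => /eqP; rewrite intr_eq0 (negbTE t0).
by have := shift 1 isT; have := shift (-1) isT; rewrite mulN1r mul1r; lra.
Qed.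

End Eikonal.

(** * Mechanical Hamiltonians *)

Section MechanicalMetric.
Context {R : realType} {n : nat} (A : 'rV[R]_n -> 'M[R]_n) (V : 'rV[R]_n -> R).
Context (A_posdef : forall x, posdefmx (A x)).
Context (A_smooth : forall i j : 'I_n, smooth (fun x => A x i j)).
Context (A_periodic : Zperiodic A) (V_smooth : smooth V) (V_periodic : Zperiodic V).
Context (al g : R) (g0 : 0 < g) (Vg : forall x, g <= al - V x).
Implicit Types (x p : 'rV[R]_n).

(* The level set H = al is the unit sphere of this cometric. *)
Definition cometric x : 'M[R]_n := (2 * (al - V x))^-1 *: A x.

Let gap x : 0 < 2 * (al - V x).
Proof. by rewrite mulr_gt0// (lt_le_trans g0). Qed.

Lemma bform_cometric x p q :
  bform (cometric x) p q = (2 * (al - V x))^-1 * dot (p *m (A x)^T) q.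
Proof.
have [symA _] := A_posdef x.
by rewrite symA /bform /cometric -scalemxAr dotZl.
Qed.

Lemma cometric_posdef x p : p != 0 -> 0 < bform (cometric x) p p.
Proof.
move=> p0; rewrite bform_cometric mulr_gt0 ?invr_gt0//.
exact: (proj2 (A_posdef x)).
Qed.

Lemma cometric_psdmx x : psdmx (cometric x).
Proof.
split=> [|p]; first by rewrite linearZ/= (proj1 (A_posdef x)).
have [->|p0] := eqVneq p 0; first by rewrite bform0l.
by rewrite ltW// cometric_posdef.
Qed.

Lemma cometric_def x p : mnorm (cometric x) p = 0 -> p = 0.
Proof.
move=> p0; apply: contrapT => /eqP/(cometric_posdef x).
by rewrite -sqr_mnorm ?p0 ?expr0n ?ltxx//; exact: cometric_psdmx.
Qed.

Lemma cometric_det x : \det (cometric x) != 0.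
Proof.
apply/det0P => -[p p0 pa]; have := cometric_posdef x p0.
by rewrite /bform pa dot0l ltxx.
Qed.

Lemma taylor1_cometric i j : taylor1 (fun x => cometric x i j).
Proof.
rewrite (_ : (fun _ => _) = fun x => (2 * (al + -1 * V x))^-1 * A x i j); last first.
  by apply/funext => x; rewrite mxE mulN1r.
apply: taylor1M; last first.
  apply: Zperiodic_Ck2_taylor1; last exact: (A_smooth i j 2).
  by move=> k x; rewrite A_periodic.
apply: taylor1V; last by exists (2 * g) => [|x];
  [rewrite mulr_gt0|rewrite mulN1r ler_wpM2l].
apply: taylor1M; first exact: taylor1_cst.
apply: taylor1D; first exact: taylor1_cst.
apply: taylor1M; first exact: taylor1_cst.
exact: Zperiodic_Ck2_taylor1 V_periodic (V_smooth 2).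
Qed.

Lemma cometric_regular : exists K,
  regular_metric cometric (fun x => invmx (cometric x)) K.
Proof.
(* det^2 is periodic, continuous and positive, hence bounded below, which controls the inverse
   matrix uniformly. *)
have det_periodic : Zperiodic (fun x => \det (cometric x) * \det (cometric x)).
  by move=> k x; rewrite /cometric A_periodic V_periodic.
have Tdet := taylor1_det taylor1_cometric.
have detb : exists2 d, 0 < d & forall x, d <= \det (cometric x) * \det (cometric x).
  apply: (Zperiodic_min_gt0 det_periodic).
    exact: taylor1_continuous (taylor1M Tdet Tdet).
  by move=> x; rewrite -expr2 exprn_even_gt0//= cometric_det.
have [Ka Ka0 [aub alip _]] := taylor1_form_bounds taylor1_cometric.
have [Kb Kb0 [bub blip btay]] := taylor1_form_bounds (taylor1_invmx
  taylor1_cometric detb).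
have unit_a x : cometric x \in unitmx by rewrite unitmxE unitfE cometric_det.
have KaK : Ka <= 1 + Ka + Kb by lra.
have KbK : Kb <= 1 + Ka + Kb by lra.
exists (1 + Ka + Kb); split=> //.
- by lra.
- exact: cometric_psdmx.
- move=> x; have [syma _] := cometric_psdmx x.
  split=> [|v]; first by rewrite trmx_inv syma.
  have -> : bform (invmx (cometric x)) v v =
      bform (cometric x) (v *m invmx (cometric x)) (v *m invmx (cometric x)).
    by rewrite /bform -mulmxA mulVmx// mulmx1 dotC.
  exact: (proj2 (cometric_psdmx x)).
- by move=> x; rewrite mulmxV.
- by move=> x p; apply: (le_trans (aub x p)); rewrite ler_wpM2r ?sqr_ge0.
- by move=> x p; apply: (le_trans (bub x p)); rewrite ler_wpM2r ?sqr_ge0.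
- move=> x y p; apply: (le_trans (alip x y p p)).
  rewrite -[leLHS]mulrA -expr2 ler_wpM2r ?sqr_ge0//.
  by rewrite ler_wpM2r ?enorm_ge0.
- move=> x y v v'; apply: (le_trans (blip x y v v')).
  by do 3!rewrite ler_wpM2r ?enorm_ge0//.
move=> x v; have [h hP] := btay x v; exists h => xi.
apply: (le_trans (hP xi)); rewrite lerD2l.
by do 2!rewrite ler_wpM2r ?sqr_ge0//.
Qed.

Lemma hamiltonian_le x p :
  (hamiltonian A V x p <= al) = (mnorm (cometric x) p <= 1).
Proof.
rewrite -[RHS](@ler_pXn2r _ 2) ?nnegrE ?mnorm_ge0// expr1n.
rewrite sqr_mnorm ?bform_cometric; last exact: cometric_psdmx.
rewrite mulrC ler_pdivrMr// mul1r /hamiltonian -lerBrDr.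
by rewrite mulrC ler_pdivrMr// [_ * 2]mulrC.
Qed.

Lemma hamiltonian_ge x p :
  (al <= hamiltonian A V x p) = (1 <= mnorm (cometric x) p).
Proof.
rewrite -[RHS](@ler_pXn2r _ 2) ?nnegrE ?mnorm_ge0// expr1n.
rewrite sqr_mnorm ?bform_cometric; last exact: cometric_psdmx.
rewrite mulrC ler_pdivlMr// mul1r /hamiltonian -lerBlDr.
by rewrite [2^-1 * _]mulrC ler_pdivlMr// [_ * 2]mulrC.
Qed.

End MechanicalMetric.

(** * Extraction of a singular arc from a singular point *)

Lemma prox_compact (R : realType) (n : nat) (u : 'rV[R]_n -> R) (C B : R)
    (x : 'rV[R]_n) :
  (forall p, prox u C x p -> enorm p <= B) -> compact [set p | prox u C x p].
Proof.
move=> pB.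
have pcl : closed [set p | prox u C x p].
  have -> : [set p | prox u C x p] = \bigcap_(xi in [set: 'rV[R]_n])
      [set p | u (x + xi) - u x - C * enorm xi ^+ 2 <= dot xi p].
    apply/seteqP; split=> [p up xi _ /=|p up xi].
      by have := up xi; rewrite (dotC xi); lra.
    by have := up xi Logic.I; rewrite /= (dotC xi); lra.
  apply: closed_bigI => xi _.
  exact: (closed_comp (fun p _ => @continuous_dotl R n xi p) (@closed_ge R _)).
apply: subclosed_compact pcl (@compact_enorm_ball R n 0 B) _ => p /pB.
by rewrite /= subr0.
Qed.

Lemma prox_convex (R : realType) (n : nat) (u : 'rV[R]_n -> R) (C : R)
    (x : 'rV[R]_n) : convex [set p | prox u C x p].
Proof.
move=> p q t up uq /andP[t0 t1] xi; have := up xi; have := uq xi.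
rewrite dotDl dotZl dotBl => h1 h2.
have t1' : 0 <= 1 - t by rewrite subr_ge0.
by have := ler_wpM2l t0 h1; have := ler_wpM2l t1' h2; lra.
Qed.

Theorem theorem3p10 (R : realType) (n : nat)
    (A : 'rV[R]_n -> 'M[R]_n) (V : 'rV[R]_n -> R)
    (A_posdef : forall x, posdefmx (A x))
    (A_smooth : forall i j : 'I_n, smooth (fun x => A x i j))
    (A_periodic : Zperiodic A)
    (V_smooth : smooth V)
    (V_periodic : Zperiodic V)
    (c : 'rV[R]_n)
    (alpha_gt : sup (range V) < mather_alpha (hamiltonian A V) c)
    (u : 'rV[R]_n -> R)
    (u_periodic : Zperiodic u)
    (u_semiconcave : semiconcave setT u)
    (u_solution : viscosity_solution (hamiltonian A V) c
                    (mather_alpha (hamiltonian A V) c) u)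
    (x0 : 'rV[R]_n) (x0_singular : singular_set u x0) :
  exists (tau : R) (x : R -> 'rV[R]_n) (v : 'rV[R]_n),
    [/\ 0 < tau,
        exists L : R, L.-lipschitz_(`[0, tau[) x,
        x 0 = x0,
        h^-1 *: (x h - x 0) @[h --> 0^'+] --> v /\ v != 0 &
        forall t : R, 0 <= t < tau -> singular_set u (x t)].
Proof.
set al := mather_alpha _ _ in alpha_gt u_solution *.
have [cu uvisc] := u_solution.
have [C C0 uC] := semiconcave_midsc u_semiconcave.
have [B0 _ uB] := Zperiodic_bounded u_periodic cu.
have Vg x : al - sup (range V) <= al - V x.
  rewrite lerD2l lerN2; apply: sup_ubound; last by exists x.
  have [B _ VB] := Zperiodic_bounded V_periodic (V_smooth 0%N).
  by exists B => _ [y _ <-]; exact: le_trans (ler_norm _) (VB y).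
have g0 : 0 < al - sup (range V) by rewrite subr_gt0.
have [K mab] := cometric_regular A_posdef A_smooth A_periodic V_smooth V_periodic g0 Vg.
set a := cometric A V al in mab.
have u_sub x p : prox u C x p -> mnorm (a x) (c + p) <= 1.
  move=> up; rewrite -(hamiltonian_le A_posdef g0 Vg).
  by apply: (proj1 (uvisc x)); apply/(superdiffP x p uC).
have u_super x p M : (forall xi, u x + dot p xi - M * enorm xi ^+ 2 <= u (x + xi)) ->
    1 <= mnorm (a x) (c + p).
  move=> up; rewrite -(hamiltonian_ge A_posdef g0 Vg).
  by apply: (proj2 (uvisc x)); exact: subdiff_of_touching_below up.
have eik := exists_eikonal_prox mab cu uB C0 uC u_sub u_super.
have pB := prox_enorm mab u_sub.
(* The superdifferential at x0 is nonempty, so singularity means that it has a second element. *)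
have [p1 up1 _] := eik x0.
have [p2 up2 p12] : exists2 p2, prox u C x0 p2 & p1 != p2.
  apply: contrapT => np2; apply: x0_singular; exists p1.
  apply/seteqP; split=> [p /(superdiffP _ _ uC) up|p ->];
    last exact/(superdiffP _ _ uC).
  by apply: contrapT => pp1; apply: np2; exists p => //; rewrite eq_sym; apply/eqP.
(* Two distinct vectors force a positive dimension. *)
have [i _] : exists i, p1 0 i != p2 0 i.
  apply: contrapT => ni; move/eqP: p12; apply; apply/rowP => i.
  by apply: contrapT => /eqP pi; apply: ni; exists i.
have [e e1 ue] : exists2 e, mnorm (a x0) (c + e) <= 1 & ~ prox u C x0 e.
  apply: contrapT => ne.
  apply: (not_full_superdiff mab cu uB C0 uC u_sub u_super u_periodic i (x0 := x0)).
  by move=> p p1'; apply: contrapT => np; apply: ne; exists p.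
have [r [q [ur r1 q0 qr]]] := exists_interior_normal (cometric_psdmx A_posdef g0 Vg x0)
  (mnorm_cometric_le mab x0) (@cometric_def _ _ _ _ A_posdef _ _ g0 Vg x0)
  (prox_compact (pB x0)) (@prox_convex _ _ u C x0) (u_sub x0) up1 up2 p12 e1 ue.
have [tau [x [P [tau0 xL x00 xd [xP Pr]]]]] := exists_arc cu uB C0 uC pB ur qr.
have [|d d0 dlt] := near_lt1 mab (g := mnorm (a x0) (c + r)).
  by rewrite mnorm_ge0.
have [s s0 sP] := Pr d d0.
exists (Num.min tau s), x, q; split.
- by rewrite lt_min tau0 s0.
- have [L LP] := xL; exists L => -[t t'] /= []; rewrite !in_itv/= !lt_min.
  move=> /and3P[t0 tt _] /and3P[t'0 t't _]; apply: (LP (t, t')).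
  by split; rewrite /= in_itv/= ?t0 ?t'0.
- exact: x00.
- by split.
move=> t /andP[]; rewrite le_eqVlt => /orP[/eqP<- _|t0]; first by rewrite x00.
rewrite lt_min => /andP[_ ts] [p' p'P].
have eqp p : prox u C (x t) p -> p = p'.
  by move/(superdiffP _ _ uC); rewrite p'P.
have [p'' /eqp-> p''1] := eik (x t).
have := xP t t0; move=> up; have Pp := eqp _ up.
have [|xd' Pd] := sP t; first by rewrite t0.
have := @mnorm_cometric_near _ _ _ _ _ mab x0 (x t) (c + r) (c + p') d.
rewrite -Pp => /(_ (prox_enorm_shift mab u_sub up) (ltW xd')).
rewrite opprD addrACA subrr add0r => /(_ (ltW Pd)).
by rewrite Pp p''1 expr1n leNgt dlt.
Qed.
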